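(* (ZFC) Let $\mu$ be a singular cardinal and $\bar p=\langle p_\delta:\delta<\mu^+\rangle$ a sequence of partitions $p_\delta:[\mu^+]^2\to n_\delta$ with $n_\delta<\omega$. If $\mu^+\nrightarrow[\mu^+]^2_{\mu^+}$ holds, then both $\Pr_1(\mu^+,\mu^+,\mu^+,\operatorname{cf}(\mu))_{\bar p}$ and $\Pr_0(\mu^+,\mu^+,\mu^+,\aleph_0)_{\bar p}$ hold.
   Context: $\kappa\nrightarrow[\kappa]^2_\lambda$: there is $f:[\kappa]^2\to\lambda$ with $\operatorname{ran}(f\restriction[A]^2)=\lambda$ for every $A\in[\kappa]^\kappa$. For $p:[\kappa]^2\to\theta$: $\Pr_1(\kappa,\mu,\lambda,\chi)_p$ means there is $f:[\kappa]^2\to\lambda$ such that for every $\xi<\chi$, every family $\mathcal A\subseteq[\kappa]^{<\xi}$ of $\mu$ pairwise disjoint nonempty sets, and every $\zeta\in\lambda^\theta$, there are $a,b\in\mathcal A$ with $\max a<\min b$ and $f(\alpha,\beta)=\zeta(p(\alpha,\beta))$ for all $\alpha\in a,\beta\in b$. $\Pr_0(\kappa,\mu,\lambda,\chi)_p$ means there is $f$ such that for every $\xi<\chi$, every pairwise disjoint $\mathcal A\subseteq[\kappa]^\xi$ with $|\mathcal A|=\mu$ and every matrix $\langle\zeta_{i,j}:i,j<\xi\rangle$ of elements of $\lambda^\theta$, there are $a,b\in\mathcal A$ with $\max a<\min b$ and $f(a(i),b(j))=\zeta_{i,j}(p(a(i),b(j)))$ for all $i,j<\xi$ ($a(i)$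 the $i$-th element of $a$ in increasing order). With a sequence $\bar p=\langle p_\delta\rangle$: a single $f$ witnesses the symbol for every $p_\delta$. *)

(* Defs.v *)
(* set theory is encoded
   from scratch: cardinals/ordinals are types carrying well-orders. *)
From mathcomp Require Import all_boot.
Set Implicit Arguments. Unset Strict Implicit. Unset Printing Implicit Defensive.

Definition card_le (A B : Type) : Prop := exists f : A -> B, injective f.
Definition card_lt (A B : Type) : Prop := card_le A B /\ ~ card_le B A.

Definition is_wellorder (T : Type) (R : T -> T -> Prop) : Prop :=
  well_founded R /\ (forall x y z, R x y -> R y z -> R x z) /\
  (forall x y, R x y \/ x = y \/ R y x).

Definition is_cardinal (T : Type) (R : T -> T -> Prop) : Prop :=
  is_wellorder R /\ forall a : T, card_lt {x : T | R x a} T.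

Definition unbounded (T : Type) (R : T -> T -> Prop) (S : T -> Prop) : Prop :=
  forall x : T, exists y, S y /\ ~ R y x.

Definition singular_cardinal (M : Type) (R : M -> M -> Prop) : Prop :=
  is_cardinal R /\ card_le nat M /\
  exists S : M -> Prop, unbounded R S /\ card_lt {x : M | S x} M.

Definition card_lt_cf (M : Type) (R : M -> M -> Prop) (X : Type) : Prop :=
  forall S : M -> Prop, card_le {x : M | S x} X -> ~ unbounded R S.

Definition is_succ_card (K : Type) (lt : K -> K -> Prop) (M : Type) : Prop :=
  is_wellorder lt /\ (forall a : K, card_le {x : K | lt x a} M) /\ ~ card_le K M.

Definition neg_sq_brackets (K : Type) (lt : K -> K -> Prop) : Prop :=
  exists f : K -> K -> K,
    forall A : K -> Prop, card_le K {x : K | A x} ->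
    forall g : K, exists a b, A a /\ A b /\ lt a b /\ f a b = g.

(* Pr_1(kappa, kappa, kappa, cf(M))_{pbar} with kappa = (K,lt), sequence
   pbar = (p d)_{d in K}, p d : [kappa]^2 -> n d.  A family of kappa many
   pairwise disjoint nonempty sets is indexed injectively by K; the bound
   "A subset [kappa]^{<xi} for some xi < cf(M)" is rendered as
   "all members have size <= |X| for some X with |X| < cf(M)". *)
Definition Pr1_seq (K : Type) (lt : K -> K -> Prop) (M : Type)
  (R : M -> M -> Prop) (n : K -> nat) (p : forall d : K, K -> K -> 'I_(n d))
  : Prop :=
  exists f : K -> K -> K,
    forall (d : K) (X : Type), card_lt_cf R X ->
    forall F : K -> K -> Prop,
      (forall i j, i <> j -> forall x, F i x -> F j x -> False) ->
      (forall i, exists x, F i x) ->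
      (forall i, card_le {x : K | F i x} X) ->
    forall zeta : 'I_(n d) -> K,
    exists i j,
      (forall a b, F i a -> F j b -> lt a b) /\
      (forall a b, F i a -> F j b -> f a b = zeta (p d a b)).

(* Pr_0(kappa, kappa, kappa, aleph_0)_{pbar}: families of kappa many pairwise
   disjoint sets of size xi < omega, each given by its increasing
   enumeration F k : 'I_xi -> K, indexed injectively by K. *)
Definition Pr0_seq (K : Type) (lt : K -> K -> Prop)
  (n : K -> nat) (p : forall d : K, K -> K -> 'I_(n d)) : Prop :=
  exists f : K -> K -> K,
    forall (d : K) (xi : nat) (F : K -> 'I_xi -> K),
      (forall k (i j : 'I_xi), (i < j)%N -> lt (F k i) (F k j)) ->
      (forall k l, k <> l -> forall i j, F k i <> F l j) ->
    forall Z : 'I_xi -> 'I_xi -> 'I_(n d) -> K,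
    exists k l,
      (forall i j, lt (F k i) (F l j)) /\
      (forall i j, f (F k i) (F l j) = Z i j (p d (F k i) (F l j))).

(* Main.v *)
(* Write [K] for the successor of the singular cardinal [M], and [M] as the
   increasing union of smaller sets [Mk k] for [k] in the cofinality [T].

   Two objects exist outright.  First, a system of sets [A b k] of size at most
   [Mk k] guesses clubs: for every club [E] of [K] there are an ordinal [d] and,
   for unboundedly many [k], a point of [E] of cofinality greater than [Mk k]
   which belongs to [A b k] as soon as [b > d] and [k] is large.  Second, a scale
   for [K] yields a colouring [h : [K]^2 -> T] which on every family of [K]
   small sets takes each large colour constantly on some rectangle.

   Given small sets [t x], the pairs [a, b] in a rectangle are sent to one pair
   [a1 < b1] as follows.  Points [b1 < b2] are fixed, both of large cofinality,
   so that the members of [t y] have [b2] in their [k1]-th set, which is bounded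
   below [b2], and [b2] has [b1] in its [k2]-th set.  If [a < b1] is close to
   [b1] then [b2] is the first element of [A b k1] above [a], and [b1] the first
   element of [A b2 k2] above [a].  The supremum [e] of [A b2 k2] below [b1] is
   independent of [b1] on a stationary set, so the same descent from [a] to [e]
   recovers [a1]; [k1] and [k2] are read off [h a b].  Composing with the given
   square colouring realizes every colour on a rectangle of the family, and the
   partitions are handled by letting colours code functions. *)
From Stdlib Require Import Classical ClassicalEpsilon FunctionalExtensionality PropExtensionality.
Require Import Defs.
From mathcomp Require Import all_boot.
Set Implicit Arguments. Unset Strict Implicit. Unset Printing Implicit Defensive.


(** * Well-orders and cardinalities *)

Definition surj (A B : Type) := exists e : A -> B, forall b, exists a, e a = b.

Lemma ac A B (R : A -> B -> Prop) :
  (forall x, exists y, R x y) -> exists f, forall x, R x (f x).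
Proof.
move=> H; exists (fun x => proj1_sig (constructive_indefinite_description _ (H x))).
by move=> x; case: constructive_indefinite_description.
Qed.

Lemma ac_in A B (P : A -> Prop) (R : A -> B -> Prop) : inhabited B ->
  (forall x, P x -> exists y, R x y) -> exists f, forall x, P x -> R x (f x).
Proof.
move=> iB H; apply: (@ac A B (fun x y => P x -> R x y)) => x.
case: (classic (P x)) => [/H [y Hy]|nP]; first by exists y.
by case: iB => b; exists b.
Qed.

Lemma not_all_ex A (P : A -> Prop) : ~ (forall x, P x) -> exists x, ~ P x.
Proof. exact: not_all_ex_not. Qed.

Lemma card_le_refl A : card_le A A.
Proof. by exists id. Qed.

Lemma card_le_trans A B C : card_le A B -> card_le B C -> card_le A C.
Proof. by move=> [f fi] [g gi]; exists (g \o f); apply: inj_comp. Qed.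

Lemma surj_card_le A B : surj A B -> card_le B A.
Proof.
move=> [e /ac [g Hg]]; exists g => x y E.
by rewrite -(Hg x) -(Hg y) E.
Qed.

Lemma card_le_surj A B : inhabited B -> card_le B A -> surj A B.
Proof.
move=> iB [f fi].
have [g Hg] : exists g : A -> B, forall a, (exists b, f b = a) -> f (g a) = a.
  by apply: (ac_in (P := fun a => exists b, f b = a) (R := fun a b => f b = a)).
exists g => b; exists (f b); apply: fi; apply: Hg; by exists b.
Qed.

Lemma card_le_pair A B C D : card_le A C -> card_le B D -> card_le (A * B) (C * D).
Proof.
move=> [f fi] [g gi]; exists (fun p => (f p.1, g p.2)).
by move=> [a b] [a' b'] /= [/fi -> /gi ->].
Qed.

Lemma card_le_sig A (P Q : A -> Prop) :
  (forall x, P x -> Q x) -> card_le {x | P x} {x | Q x}.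
Proof.
move=> H; exists (fun p => exist _ (proj1_sig p) (H _ (proj2_sig p))).
move=> [x p] [y q] /= [E]; move: p q; rewrite E => p q.
by rewrite (proof_irrelevance _ p q).
Qed.

Lemma card_le_proj A (P : A -> Prop) : card_le {x | P x} A.
Proof.
exists (@proj1_sig _ _) => [[x p] [y q]] /= E; move: p q; rewrite E => p q.
by rewrite (proof_irrelevance _ p q).
Qed.

(** Recursion with choice: [P w u v] depends on [u] only below [w], so the values can be picked one
    after another, and the finished function meets each requirement with itself as the history. *)
Lemma wf_choice W (lt : W -> W -> Prop) T (P : W -> (W -> T) -> T -> Prop) :
  well_founded lt -> inhabited T ->
  (forall w u u' v, (forall w', lt w' w -> u w' = u' w') -> P w u v -> P w u' v) ->
  (forall w u, exists v, P w u v) ->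
  exists u, forall w, P w u (u w).
Proof.
move=> wf iT loc tot; have [d] := iT.
(* The partial history below [w] is extended by the default [d]; locality of [P] makes the default
   harmless. *)
pose ext w (r : forall w', lt w' w -> T) w' :=
  match excluded_middle_informative (lt w' w) with
  | left p => r w' p | right _ => d end.
pose F w (r : forall w', lt w' w -> T) := epsilon iT (P w (ext w r)).
pose u := Fix wf (fun _ => T) F.
have uE w : u w = F w (fun w' _ => u w').
  apply: Fix_eq => x f g fg; congr F; apply: functional_extensionality_dep => y.
  by apply: functional_extensionality_dep => p.
exists u => w.
have H : P w (ext w (fun w' _ => u w')) (u w).
  by rewrite uE /F; apply: epsilon_spec; apply: tot.
apply: loc H => w' lw; rewrite /ext.
by case: excluded_middle_informative.
Qed.

(** A total operator: [w0] only supplies inhabitation, and the value is unspecified when [P] is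
    empty. *)
Definition lmin W (lt : W -> W -> Prop) (w0 : W) (P : W -> Prop) : W :=
  epsilon (inhabits w0) (fun x => P x /\ forall y, P y -> ~ lt y x).

Section WellOrder.
Variables (W : Type) (lt : W -> W -> Prop).
Hypothesis wo : is_wellorder lt.

Lemma wo_wf : well_founded lt. Proof. by case: wo. Qed.

Lemma lt_tr x y z : lt x y -> lt y z -> lt x z.
Proof. by case: wo => _ [H _]; apply: H. Qed.

Lemma lt_irr x : ~ lt x x.
Proof. by elim: (wo_wf x) => {}x _ IH H; apply: (IH x). Qed.

Lemma lt_asym x y : lt x y -> ~ lt y x.
Proof. by move=> xy yx; apply: (@lt_irr x); apply: lt_tr yx. Qed.

Lemma nlt_tri x y : ~ lt x y -> x = y \/ lt y x.
Proof. by case: wo => _ [_ /(_ x y)] [|[->|]]; auto. Qed.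

Lemma nlt_lt_tr x y z : ~ lt y x -> lt y z -> lt x z.
Proof. by move=> /nlt_tri [->|xy] // yz; apply: lt_tr yz. Qed.

Lemma lt_nlt_tr x y z : lt x y -> ~ lt z y -> lt x z.
Proof. by move=> xy /nlt_tri [->|yz] //; apply: lt_tr yz. Qed.

Lemma nlt_tr x y z : ~ lt y x -> ~ lt z y -> ~ lt z x.
Proof. by move=> yx zy zx; apply: zy; apply: lt_nlt_tr zx yx. Qed.

Lemma nlt_anti x y : ~ lt x y -> ~ lt y x -> x = y.
Proof. by move=> /nlt_tri [|]. Qed.

Lemma ex_least (P : W -> Prop) : (exists x, P x) ->
  exists x, P x /\ forall y, P y -> ~ lt y x.
Proof.
move=> [x Px]; apply: NNPP => nE; move: Px; elim: (wo_wf x) => {}x _ IH Px.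
apply: nE; exists x; split=> // y Py yx; exact: (IH y).
Qed.

Lemma lmin_spec w0 (P : W -> Prop) : (exists x, P x) ->
  P (lmin lt w0 P) /\ forall y, P y -> ~ lt y (lmin lt w0 P).
Proof. by move=> /ex_least H; exact: (epsilon_spec (inhabits w0) _ H). Qed.

Lemma lmin_unique w0 (P : W -> Prop) x :
  P x -> (forall y, P y -> ~ lt y x) -> lmin lt w0 P = x.
Proof.
move=> Px Hx; have [Pm Hm] := @lmin_spec w0 P (ex_intro _ x Px).
by apply: nlt_anti; [apply: Hx | apply: Hm].
Qed.

Lemma ex_ub2 x y : exists z, ~ lt z x /\ ~ lt z y /\ (z = x \/ z = y).
Proof.
case: (classic (lt x y)) => xy; [exists y|exists x]; split; auto.
- exact: lt_asym.
- by split; auto; exact: lt_irr.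
- exact: lt_irr.
Qed.

(* Transfinite enumeration of [B] along [W]: it either never stops, which
   embeds [W] into [B], or exhausts [B] at some stage. *)
Lemma enum_dichotomy (B : Type) : inhabited B ->
  card_le W B \/ exists w (e : W -> B), forall b, exists x, lt x w /\ e x = b.
Proof.
move=> iB.
have [u Hu] : exists u : W -> B, forall w,
    (exists t, forall w', lt w' w -> u w' <> t) -> forall w', lt w' w -> u w' <> u w.
  refine (wf_choice (P := fun w (u : W -> B) v => (exists t, forall w', lt w' w -> u w' <> t) ->
      forall w', lt w' w -> u w' <> v) wo_wf iB _ _).
  - move=> w u u' v E H [t Ht] w' lw; rewrite -(E _ lw); apply: (H _ _ lw).
    by exists t => x lx; rewrite (E _ lx); apply: Ht.
  - move=> w u; case: (classic (exists t, forall w', lt w' w -> u w' <> t)).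
      by move=> [t Ht]; exists t.
    by move=> nt; case: iB => b; exists b.
case: (classic (forall w, exists t, forall w', lt w' w -> u w' <> t)) => [H|].
  left; exists u => x y E; apply: nlt_anti => L.
    by apply: (Hu y (H y) x L).
  by apply: (Hu x (H x) y L).
move=> /not_all_ex [w nw]; right; exists w, u => b; apply: NNPP => nb.
by apply: nw; exists b => x lx E; apply: nb; exists x.
Qed.

End WellOrder.


(** * Squares and finite sequences of infinite sets *)

Lemma wf_least W (lt : W -> W -> Prop) :
  (forall P : W -> Prop, (exists x, P x) -> exists x, P x /\ forall y, P y -> ~ lt y x) ->
  well_founded lt.
Proof.
move=> H w; apply: NNPP => nw.
have [x [nx Hx]] := H (fun x => ~ Acc lt x) (ex_intro _ w nw).
by apply: nx; constructor => y yx; apply: NNPP => /Hx; apply.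
Qed.

Definition lex A B (ltA : A -> A -> Prop) (ltB : B -> B -> Prop) (p q : A * B) :=
  ltA p.1 q.1 \/ (p.1 = q.1 /\ ltB p.2 q.2).

Lemma lex_wo A B (ltA : A -> A -> Prop) (ltB : B -> B -> Prop) :
  is_wellorder ltA -> is_wellorder ltB -> is_wellorder (lex ltA ltB).
Proof.
move=> wA wB; split; [|split].
- apply: wf_least => P [[a b] Pab].
  have [x [[y Py] Hx]] := ex_least wA (ex_intro (fun a => exists b, P (a, b)) a (ex_intro _ b Pab)).
  have [z [Pz Hz]] := ex_least wB (ex_intro (fun b => P (x, b)) y Py).
  exists (x, z); split=> // -[u v] Puv [/= L|[/= E L]].
    by apply: Hx L; exists v.
  by apply: (Hz v) => //; rewrite -E.
- move=> [a b] [a' b'] [a'' b''] [/= L|[/= -> L]] [/= L'|[/= <- L']].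
  + by left; apply: lt_tr L'.
  + by left.
  + by left.
  + by right; split=> //=; apply: lt_tr L'.
- move=> [a b] [a' b']; rewrite /lex /=.
  case: wA => _ [_ /(_ a a')] [|[->|]]; auto.
  by case: wB => _ [_ /(_ b b')] [|[->|]]; auto.
Qed.

Lemma inj_wo A B (ltB : B -> B -> Prop) (f : A -> B) :
  injective f -> is_wellorder ltB -> is_wellorder (fun x y => ltB (f x) (f y)).
Proof.
move=> fi wB; split; [|split].
- apply: wf_least => P [x Px].
  have [b [[y [<- Py]] Hb]] :=
    ex_least wB (ex_intro (fun b => exists a, f a = b /\ P a) (f x) (ex_intro _ x (conj erefl Px))).
  by exists y; split=> // z Pz L; apply: Hb L; exists z.
- by move=> x y z; apply: lt_tr.
- move=> x y; case: wB => _ [_ /(_ (f x) (f y))] [|[/fi ->|]]; auto.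
Qed.

Lemma seg_wo W (lt : W -> W -> Prop) (P : W -> Prop) : is_wellorder lt ->
  is_wellorder (fun x y : {x | P x} => lt (proj1_sig x) (proj1_sig y)).
Proof.
apply: inj_wo => -[x p] [y q] /= E; move: p q; rewrite E => p q.
by rewrite (proof_irrelevance _ p q).
Qed.

Lemma nat_wo : is_wellorder (fun m n : nat => m < n).
Proof.
split; [|split].
- by move=> n; elim/ltn_ind: n => n IH; constructor.
- by move=> x y z; apply: ltn_trans.
- by move=> x y; case: (ltngtP x y); auto.
Qed.

Definition finite (A : Type) := exists n (e : 'I_n -> A), forall a, exists i, e i = a.

Lemma infinite_or_finite A : inhabited A -> card_le nat A \/ finite A.
Proof.
move=> iA; case: (enum_dichotomy nat_wo iA) => [|[n [e He]]]; first by left.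
right; exists n, (fun i : 'I_n => e i) => a.
by have [x [lx <-]] := He a; exists (Ordinal lx).
Qed.

Lemma finType_not_infinite (T : finType) A (e : T -> A) :
  (forall a, exists t, e t = a) -> ~ card_le nat A.
Proof.
move=> He [f fi].
have [g Hg] : exists g : nat -> T, forall n, e (g n) = f n.
  by apply: (ac (R := fun n t => e t = f n)).
have gi : injective (fun i : 'I_(#|T|.+1) => g i).
  by move=> i j E; apply: val_inj; apply: fi; rewrite -!Hg E.
by have := leq_card _ gi; rewrite card_ord ltnn.
Qed.

(** The extra point is absorbed by a shift along a copy of [nat] inside [A]. *)
Lemma option_le A : card_le nat A -> card_le (option A) A.
Proof.
move=> [f fi].
have [g Hg] : exists g : option A -> A, forall o, match o with
   | None => g o = f 0
   | Some a => (exists n, a = f n /\ g o = f n.+1) \/ ((forall n, a <> f n) /\ g o = a) end.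
  apply: (ac (R := fun o b => match o with
   | None => b = f 0
   | Some a => (exists n, a = f n /\ b = f n.+1) \/ ((forall n, a <> f n) /\ b = a) end)).
  case=> [a|]; last by exists (f 0).
  case: (classic (exists n, a = f n)) => [[n E]|H].
    by exists (f n.+1); left; exists n.
  by exists a; right; split=> // n E; apply: H; exists n.
exists g => -[a|] [b|] E //.
- have := Hg (Some a); have := Hg (Some b); rewrite E.
  move=> [[n [-> ->]]|[nb ->]] [[m [-> Em]]|[na Ea]].
  + by have [->] := fi _ _ Em.
  + by case: (na n.+1).
  + by case: (nb m.+1).
  + by rewrite Ea.
- have := Hg (Some a); rewrite E (Hg None) => -[[n [_ /fi]] //|[na Ea]].
  by case: (na 0).
- have := Hg (Some b); rewrite -E (Hg None) => -[[n [_ /fi]] //|[na Ea]].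
  by case: (na 0).
Qed.

Lemma nlt_le_option W (lt : W -> W -> Prop) m : is_wellorder lt ->
  card_le {z | ~ lt m z} (option {z | lt z m}).
Proof.
move=> wo; pose k (z : {z | ~ lt m z}) := match excluded_middle_informative (lt (proj1_sig z) m) with
    left p => Some (exist (fun x => lt x m) _ p) | right _ => None end.
exists k => -[x px] [y py]; rewrite /k /=.
case: excluded_middle_informative => [p|np]; case: excluded_middle_informative => [q|nq] //.
  by move=> [E]; move: px py {p q}; rewrite E => px py; rewrite (proof_irrelevance _ px py).
move=> _; have E : x = y by rewrite (nlt_anti wo np px) (nlt_anti wo nq py).
by move: px py {np nq}; rewrite E => px py; rewrite (proof_irrelevance _ px py).
Qed.

Lemma option_infinite A : card_le nat (option A) -> card_le nat A.
Proof.
move=> [f fi].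
have [n0 Hn] : exists n0, forall n, exists a, f (n0 + n) = Some a.
  case: (classic (exists n, f n = None)) => [[n E]|H]; last first.
    by exists 0 => n; case E : (f n) => [a|]; [exists a|case: H; exists n].
  exists n.+1 => m; case E' : (f _) => [a|]; first by exists a.
  by move: E'; rewrite -E => /fi /eqP; rewrite addSn -addnS -{2}(addn0 n) eqn_add2l.
have [g Hg] := ac (R := fun n a => f (n0 + n) = Some a) Hn.
by exists g => x y E; have := Hg x; rewrite E -Hg => /fi /addnI.
Qed.

(** Order pairs by their maximum, then lexicographically. If [W] did not embed this order, it would
    be exhausted by the pairs before some [w]; these lie in the square of the segment up to the
    maximum of [w], which by the hypothesis on segments is too small. *)
Lemma square_step W (lt : W -> W -> Prop) : is_wellorder lt ->
  (forall a, card_le nat {x | lt x a} ->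
     card_le ({x | lt x a} * {x | lt x a}) {x | lt x a}) ->
  card_le nat W -> card_le (W * W) W.
Proof.
move=> wo IH iW; have [i0 _] := iW; have inhW : inhabited W := inhabits (i0 0).
case: (classic (exists a, card_le W {x | lt x a})) => [[a Wa]|nW].
  have ia := card_le_trans iW Wa.
  by apply: card_le_trans (card_le_proj _); apply: card_le_trans (IH _ ia); apply: card_le_pair.
pose mx (p : W * W) := if excluded_middle_informative (lt p.1 p.2) then p.2 else p.1.
have mx1 p : ~ lt (mx p) p.1.
  by rewrite /mx; case: excluded_middle_informative => L; [apply: lt_asym|apply: lt_irr].
have mx2 p : ~ lt (mx p) p.2.
  by rewrite /mx; case: excluded_middle_informative => L //; apply: lt_irr.
have fi : injective (fun p : W * W => (mx p, p)) by move=> x y [].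
have wg := inj_wo fi (lex_wo wo (lex_wo wo wo)).
case: (enum_dichotomy wg inhW) => // -[w [e He]]; exfalso.
pose m := mx w; pose Q := {z | ~ lt m z}.
have [h Hh] : exists h : Q * Q -> W, forall b, exists p, h p = b.
  exists (fun p => e (proj1_sig p.1, proj1_sig p.2)) => b.
  have [[x y] [L <-]] := He b.
  have Lm : ~ lt m (mx (x, y)).
    by case: L => [/= /(lt_asym wo)|[/= E _]]; rewrite /m // E; apply: lt_irr.
  have Lx : ~ lt m x by apply: nlt_tr Lm; [exact: wo | exact: (mx1 (x, y))].
  have Ly : ~ lt m y by apply: nlt_tr Lm; [exact: wo | exact: (mx2 (x, y))].
  by exists (exist _ x Lx, exist _ y Ly).
have Qo : card_le Q (option {x | lt x m}) := nlt_le_option m wo.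
have WQ : card_le W (Q * Q) by apply: surj_card_le; exists h.
case: (classic (card_le nat {x | lt x m})) => [im|fm].
  have Qm := card_le_trans Qo (option_le im).
  apply: nW; exists m; apply: card_le_trans WQ _.
  by apply: card_le_trans (IH _ im); apply: card_le_pair.
have [n [q Hq]] : finite (option {x | lt x m}).
  by have [/option_infinite|] := @infinite_or_finite (option {x | lt x m}) (inhabits None).
have [i Hi] : card_le Q 'I_n by apply: (card_le_trans Qo); apply: surj_card_le; exists q.
have [r Hr] : card_le W ('I_n * 'I_n).
  by apply: card_le_trans WQ _; apply: card_le_pair; exists i.
have : surj ('I_n * 'I_n) W by apply: card_le_surj => //; exists r.
by move=> [s Hs]; apply: (@finType_not_infinite ('I_n * 'I_n)%type _ s).
Qed.

Lemma seg_seg_le W (lt : W -> W -> Prop) (a : W) (b : {x | lt x a}) : is_wellorder lt ->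
  card_le {z : {x | lt x a} | lt (proj1_sig z) (proj1_sig b)} {z | lt z (proj1_sig b)} /\
  card_le {z | lt z (proj1_sig b)} {z : {x | lt x a} | lt (proj1_sig z) (proj1_sig b)}.
Proof.
move=> wo; split.
  exists (fun z : {z : {x | lt x a} | lt (proj1_sig z) (proj1_sig b)} =>
    exist (fun x => lt x (proj1_sig b)) (proj1_sig (proj1_sig z)) (proj2_sig z)).
  move=> [[x p] q] [[y p'] q'] /= [E]; move: p q p' q'; rewrite E => p q p' q'.
  by move: q q'; rewrite (proof_irrelevance _ p p') => q q'; rewrite (proof_irrelevance _ q q').
have H (z : {z | lt z (proj1_sig b)}) : lt (proj1_sig z) a.
  by apply: lt_tr (proj2_sig b); first exact: wo; exact: (proj2_sig z).
exists (fun z => exist (fun z : {x | lt x a} => lt (proj1_sig z) (proj1_sig b))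
  (exist (fun x => lt x a) (proj1_sig z) (H z)) (proj2_sig z)).
move=> [x q] [y q'] /= [E]; move: q q'; rewrite E => q q'.
by rewrite (proof_irrelevance _ q q').
Qed.

Lemma square_le W (lt : W -> W -> Prop) : is_wellorder lt ->
  card_le nat W -> card_le (W * W) W.
Proof.
move=> wo; apply: (square_step wo) => a; elim: (wo_wf wo a) => {}a _ IH ia.
apply: (@square_step _ (fun x y : {x | lt x a} => lt (proj1_sig x) (proj1_sig y))) ia.
  exact: seg_wo.
move=> b ib; have [ab ba] := seg_seg_le b wo.
apply: card_le_trans ba; apply: card_le_trans (IH _ (proj2_sig b) (card_le_trans ib ab)).
exact: card_le_pair.
Qed.

Lemma list_le A : card_le nat A -> card_le (A * A) A -> card_le (list A) A.
Proof.
move=> [i ii] [p pi].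
pose fix enc (s : list A) := if s is x :: s' then p (i 1, p (x, enc s')) else p (i 0, i 0).
exists enc; elim=> [|x s IH] [|y t] //= /pi.
- by move=> [/ii].
- by move=> [/ii].
- by move=> [/pi [-> /IH ->]].
Qed.


(** * Clubs on regular cardinals *)

(** The size of [P] is at most that of [A], stated without the subtype of [P]: the range of [e] may
    exceed [P], so passing to subsets is immediate and the empty [P] needs no special care. *)
Definition cov (A W : Type) (P : W -> Prop) := exists e : A -> W, forall x, P x -> exists a, e a = x.
Arguments cov A {W} P.

Lemma cov_of_le A W (P : W -> Prop) : inhabited W -> card_le {x | P x} A -> cov A P.
Proof.
move=> [w0] PA; case: (classic (inhabited {x | P x})) => [iP|nP]; last first.
  by exists (fun _ => w0) => x Px; case: nP; constructor; exists x.
have [e He] := card_le_surj iP PA; exists (fun a => proj1_sig (e a)) => x Px.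
by have [a Ha] := He (exist _ x Px); exists a; rewrite Ha.
Qed.

Lemma cov_le A W (P : W -> Prop) : cov A P -> card_le {x | P x} A.
Proof.
move=> [e He].
have [g Hg] := @ac {x | P x} A (fun x a => e a = proj1_sig x) (fun x => He _ (proj2_sig x)).
exists g => -[x px] [y py] E; have := Hg (exist _ x px); have := Hg (exist _ y py).
rewrite -E => -> /= E'; move: px py {E}; rewrite E' => px py.
by rewrite (proof_irrelevance _ px py).
Qed.

Lemma cov_sub A W (P Q : W -> Prop) : (forall x, Q x -> P x) -> cov A P -> cov A Q.
Proof. by move=> QP [e He]; exists e => x /QP /He. Qed.

Lemma cov_img A W (f : A -> W) : cov A (fun x => exists a, f a = x).
Proof. by exists f. Qed.

Lemma cov_trans A B W (P : W -> Prop) : inhabited W -> card_le A B -> cov A P -> cov B P.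
Proof. by move=> iW AB /cov_le PA; apply: cov_of_le => //; apply: card_le_trans AB. Qed.

Lemma cov_union A I W (P : I -> W -> Prop) : inhabited W ->
  card_le (A * A) A -> card_le I A -> (forall i, cov A (P i)) ->
  cov A (fun x => exists i, P i x).
Proof.
move=> [w0] AA IA /ac [e He].
case: (classic (inhabited (I * A))) => [iIA|nIA]; last first.
  exists (fun _ => w0) => x [i Pix]; have [a _] := He i x Pix.
  by case: nIA; constructor.
have [s Hs] : surj A (I * A).
  apply: card_le_surj => //; apply: card_le_trans AA; apply: card_le_pair => //.
  exact: card_le_refl.
exists (fun a => e (s a).1 (s a).2) => x [i Pix]; have [a Ha] := He i x Pix.
by have [b Hb] := Hs (i, a); exists b; rewrite Hb.
Qed.

(** Abstracts the successor cardinal of [A]: short families are bounded and initial segments have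
    size at most [A]. *)
Definition reg W (lt : W -> W -> Prop) (A : Type) :=
  [/\ is_wellorder lt, inhabited W, card_le nat A,
      forall f : A -> W, exists w, forall a, lt (f a) w
    & forall x, card_le {y | lt y x} A].

(** An unbounded [f] would write [W] as a union of [A] many segments of size at most [A] together
    with the points [f a] themselves, which are the [None] case below. *)
Lemma succ_reg W (lt : W -> W -> Prop) A : card_le nat A -> card_le (A * A) A ->
  is_succ_card lt A -> reg lt A.
Proof.
move=> iA AA [wo [sA nW]].
have iW : inhabited W.
  apply: NNPP => nI; apply: nW; exists (fun w => False_rect A (nI (inhabits w))).
  by move=> w; case: nI.
split=> // f; apply: NNPP => nB; apply: nW.
have [e He] : exists e : A -> A -> W, forall a x, lt x (f a) -> exists b, e a b = x.
  apply: (ac (R := fun a (e : A -> W) => forall x, lt x (f a) -> exists b, e b = x)) => a.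
  exact: cov_of_le (sA _).
apply: (@card_le_trans _ (A * option A)).
  apply: surj_card_le.
  exists (fun p : A * option A => if p.2 is Some b then e p.1 b else f p.1) => w.
  have [a /NNPP Ha] : exists a, ~ ~ ~ lt (f a) w.
    by apply: NNPP => n; apply: nB; exists w => a; apply: NNPP => m; apply: n; exists a; auto.
  case: (nlt_tri wo Ha) => [E|/He [b E]]; first by exists (a, None).
  by exists (a, Some b).
by apply: card_le_trans AA; apply: card_le_pair; [exact: card_le_refl|exact: option_le].
Qed.

(** Closure under limits without naming them: zero fails the first condition on [d], a successor
    fails the second. *)
Definition order_closed W (lt : W -> W -> Prop) (E : W -> Prop) := forall d,
  (exists x, lt x d) -> (forall x, lt x d -> exists y, [/\ E y, lt x y & lt y d]) -> E d.
Definition unbd W (lt : W -> W -> Prop) (E : W -> Prop) := forall x, exists y, E y /\ lt x y.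
Definition club W (lt : W -> W -> Prop) E := order_closed lt E /\ unbd lt E.

(** The supremum of the points of [E] up to [x]; it belongs to [E] when [E] is closed and has a
    point there. *)
Definition last_below W (lt : W -> W -> Prop) w0 (E : W -> Prop) (x : W) :=
  lmin lt w0 (fun y => forall z, E z -> ~ lt x z -> ~ lt y z).

Section Last.
Variables (W : Type) (lt : W -> W -> Prop) (w0 : W).
Hypothesis wo : is_wellorder lt.
Implicit Types (E : W -> Prop).

Lemma last_le E x : ~ lt x (last_below lt w0 E x).
Proof.
have [_ H] := @lmin_spec _ _ wo w0 (fun y => forall z, E z -> ~ lt x z -> ~ lt y z)
   (ex_intro _ x (fun z _ H => H)).
by apply: H.
Qed.

Lemma last_ge E x z : E z -> ~ lt x z -> ~ lt (last_below lt w0 E x) z.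
Proof.
have [H _] := @lmin_spec _ _ wo w0 (fun y => forall z, E z -> ~ lt x z -> ~ lt y z)
   (ex_intro _ x (fun z _ H => H)).
exact: H.
Qed.

Lemma last_least E x y : (forall z, E z -> ~ lt x z -> ~ lt y z) -> ~ lt y (last_below lt w0 E x).
Proof.
have [_ H] := @lmin_spec _ _ wo w0 (fun y => forall z, E z -> ~ lt x z -> ~ lt y z)
   (ex_intro _ x (fun z _ H => H)).
exact: H.
Qed.

Lemma last_in E x : order_closed lt E -> (exists z, E z /\ ~ lt x z) -> E (last_below lt w0 E x).
Proof.
move=> clE [z [Ez xz]]; apply: NNPP => nE.
have neq v : E v -> ~ lt x v -> lt v (last_below lt w0 E x).
  move=> Ev xv; case: (nlt_tri wo (last_ge Ev xv)) => // E'.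
  by case: nE; rewrite E'.
apply: nE; apply: clE; first by exists z; apply: neq.
move=> y Ly; apply: NNPP => nex.
apply: (last_least (y := y)) Ly => v Ev xv yv; apply: nex; exists v; split=> //.
exact: neq.
Qed.

Lemma last_anti E E' x : (forall z, E' z -> E z) -> ~ lt (last_below lt w0 E x) (last_below lt w0 E' x).
Proof. by move=> EE; apply: last_least => z /EE; apply: last_ge. Qed.

Lemma last_mono E x y : ~ lt y x -> ~ lt (last_below lt w0 E y) (last_below lt w0 E x).
Proof.
move=> yx; apply: last_least => z Ez xz; apply: last_ge => //.
exact: nlt_tr xz yx.
Qed.

End Last.

(** A nonincreasing sequence in a well-order is constant once it has reached its least value. *)
Lemma antitone_stable W J (lt : W -> W -> Prop) (ltJ : J -> J -> Prop) (u : J -> W) :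
  is_wellorder lt -> is_wellorder ltJ -> inhabited J ->
  (forall j j', ltJ j j' -> ~ lt (u j) (u j')) ->
  exists j0, forall j, ~ ltJ j j0 -> u j = u j0.
Proof.
move=> wo woJ [j1] anti.
have [x [[j0 E] H]] := ex_least wo (ex_intro (fun x => exists j, u j = x) (u j1) (ex_intro _ j1 erefl)).
exists j0 => j /(nlt_tri woJ) [->//|/anti L]; rewrite E in L *.
by apply: (nlt_anti wo) => //; apply: H; exists j.
Qed.

Section Regular.
Variables (W : Type) (lt : W -> W -> Prop) (A : Type).
Hypothesis rW : reg lt A.

Let wo : is_wellorder lt. Proof. by case: rW. Qed.

Lemma reg_bnd B (f : B -> W) : card_le B A -> exists w, forall b, lt (f b) w.
Proof.
case: rW => _ [w0] _ H _ BA; case: (classic (inhabited B)) => [iB|nB]; last first.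
  by exists w0 => b; case: nB.
have [s Hs] := card_le_surj iB BA; have [w Hw] := H (f \o s); exists w => b.
by have [a <-] := Hs b; apply: Hw.
Qed.

Lemma reg_bnd_cov B V (P : V -> Prop) (f : V -> W) : cov B P -> card_le B A ->
  exists w, forall x, P x -> lt (f x) w.
Proof.
move=> [e He] BA; have [w Hw] := reg_bnd (f \o e) BA; exists w => x /He [b <-]; exact: Hw.
Qed.

Lemma reg_seg_cov x : cov A (fun y => lt y x).
Proof. by case: rW => _ iW _ _ /(_ x); apply: cov_of_le. Qed.

Lemma reg_bnd_lt x (f : W -> W) : exists w, forall y, lt y x -> lt (f y) w.
Proof. exact: reg_bnd_cov (reg_seg_cov x) (card_le_refl _). Qed.

Lemma reg_above x : exists y, lt x y.
Proof.
have [|y Hy] := @reg_bnd unit (fun _ => x).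
  by case: rW => _ _ [f _] _ _; exists (fun _ => f 0) => -[] [].
by exists y; apply: (Hy tt).
Qed.

Lemma reg_ub2 x y : exists z, lt x z /\ lt y z.
Proof.
have [z [zx [zy _]]] := ex_ub2 wo x y; have [w zw] := reg_above z; exists w.
by split; apply: nlt_lt_tr zw.
Qed.

Lemma unbd_card E : unbd lt E -> card_le W {x | E x}.
Proof.
move=> uE; case: rW => _ [w0] _ _ _.
have iE : inhabited {x | E x} by have [y [Ey _]] := uE w0; constructor; exists y.
case: (enum_dichotomy wo iE) => // -[w [e He]].
have [v Hv] := reg_bnd_lt w (fun x => proj1_sig (e x)).
have [y [Ey vy]] := uE v; have [x [xw ex]] := He (exist _ y Ey).
by have := Hv x xw; rewrite ex => /= yv; case: (lt_asym wo vy).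
Qed.

Definition closure_pts (phi : W -> W) d := (exists x, lt x d) /\ forall x, lt x d -> lt (phi x) d.

(** For unboundedness take the supremum of the iterates [s n]: a point below it lies at or below
    some [s n], and [psi] dominates [phi] up to there. *)
Lemma closure_club phi : club lt (closure_pts phi).
Proof.
split.
  move=> d ex H; split=> // x xd; have [y [[_ Hy] xy yd]] := H x xd.
  exact: lt_tr (Hy _ xy) yd.
move=> x0.
have [psi Hpsi] : exists psi : W -> W, forall x, lt x (psi x) /\ forall y, ~ lt x y -> lt (phi y) (psi x).
  apply: (ac (R := fun x z => lt x z /\ forall y, ~ lt x y -> lt (phi y) z)) => x.
  have [x' xx'] := reg_above x; have [w Hw] := reg_bnd_lt x' phi.
  have [z [wz xz]] := reg_ub2 w x; exists z; split=> // y xy.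
  by apply: lt_tr wz; first exact: wo; apply: Hw; apply: nlt_lt_tr xx'.
pose s n := iter n psi x0.
have [w Hw] : exists w, forall n, lt (s n) w by apply: reg_bnd; case: rW.
have [d [Hd dmin]] := ex_least wo (ex_intro (fun w => forall n, lt (s n) w) w Hw).
have Hbelow x : lt x d -> exists n, ~ lt (s n) x.
  move=> xd; apply: NNPP => n; apply: (dmin x) xd => m; apply: NNPP => nm; apply: n.
  by exists m.
exists d; split; last exact: (Hd 0).
split; first by exists x0; apply: (Hd 0).
move=> x /Hbelow [n Hn]; apply: lt_tr (Hd n.+1) => //.
by rewrite /s iterS; have [_] := Hpsi (s n); apply.
Qed.

Lemma closed_above (E : W -> Prop) (nx : W -> W) d : order_closed lt E ->
  (forall x, lt x d -> [/\ E (nx x), lt x (nx x) & lt (nx x) d]) -> (exists x, lt x d) -> E d.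
Proof. by move=> clE H ex; apply: clE => // x /H; exists (nx x). Qed.

Lemma club_inter B (E : B -> W -> Prop) : card_le B A ->
  (forall b, club lt (E b)) -> club lt (fun x => forall b, E b x).
Proof.
move=> BA cE; split.
  move=> d ex H b; have [clE _] := cE b; apply: clE => // x /H [y [Ey xy yd]].
  by exists y.
have [nx Hnx] : exists nx : B -> W -> W, forall b x, E b (nx b x) /\ lt x (nx b x).
  apply: (ac (R := fun b (f : W -> W) => forall x, E b (f x) /\ lt x (f x))) => b.
  have [_ ub] := cE b; exact: ac ub.
have [phi Hphi] : exists phi : W -> W, forall x b, lt (nx b x) (phi x).
  by apply: (ac (R := fun x w => forall b, lt (nx b x) w)) => x; apply: reg_bnd.
move=> x0; have [_ ub] := closure_club phi; have [d [[ex Hd] xd]] := ub x0.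
exists d; split=> // b; apply: (closed_above (nx := nx b)) ex; first by case: (cE b).
by move=> x xd'; have [? ?] := Hnx b x; split=> //; apply: lt_tr (Hd _ xd').
Qed.

Lemma club_inter2 E E' : club lt E -> club lt E' -> club lt (fun x => E x /\ E' x).
Proof.
move=> cE cE'; have [] := @club_inter bool (fun b => if b then E else E').
- by case: rW => _ _ [f fi] _ _; exists (fun b : bool => f b) => -[] [] // /fi.
- by case.
move=> cl ub; split.
  move=> d ex H; have Hb : forall b : bool, (if b then E else E') d.
    by apply: cl => // x /H [y [[Ey Ey'] xy yd]]; exists y; split=> // -[].
  by split; [apply: (Hb true)|apply: (Hb false)].
by move=> x; have [y [Hy xy]] := ub x; exists y; split=> //; split; [apply: (Hy true)|apply: (Hy false)].
Qed.

(** Diagonal intersection. If [d] is a closure point of [phi], every [E e] with [e] below [d] is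
    cofinal in [d], because [phi] at the larger of [x] and [e] bounds the next point of [E e]. *)
Lemma club_diag (E : W -> W -> Prop) : (forall e, club lt (E e)) ->
  club lt (fun x => forall e, lt e x -> E e x).
Proof.
move=> cE; split.
  move=> d ex H e ed; have [clE _] := cE e; apply: clE => // x xd.
  have [z [zx [ze Hz]]] := ex_ub2 wo x e.
  have [|y [Hy zy yd]] := H z; first by case: Hz => ->.
  by exists y; split=> //; [apply: Hy; apply: nlt_lt_tr zy|apply: nlt_lt_tr zy].
have [nx Hnx] : exists nx : W -> W -> W, forall b x, E b (nx b x) /\ lt x (nx b x).
  apply: (ac (R := fun b (f : W -> W) => forall x, E b (f x) /\ lt x (f x))) => b.
  have [_ ub] := cE b; exact: ac ub.
have [phi Hphi] : exists phi : W -> W, forall x b, ~ lt x b -> lt (nx b x) (phi x).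
  apply: (ac (R := fun x w => forall b, ~ lt x b -> lt (nx b x) w)) => x.
  have [x' xx'] := reg_above x; have [w Hw] := reg_bnd_lt x' (nx ^~ x).
  by exists w => b xb; apply: Hw; apply: nlt_lt_tr xx'.
move=> x0; have [_ ub] := closure_club phi; have [d [[ex Hd] xd]] := ub x0.
exists d; split=> // e ed; have [clE _] := cE e; apply: clE => // x xd'.
have [z [zx [ze Hz]]] := ex_ub2 wo x e.
have zd : lt z d by case: Hz => ->.
exists (nx e z); have [? L] := Hnx e z; split=> //; first exact: nlt_lt_tr L.
by apply: lt_tr (Hd _ zd) => //; apply: Hphi.
Qed.

Lemma club_tail x0 : club lt (fun x => lt x0 x).
Proof.
split; last by move=> x; have [z [? ?]] := reg_ub2 x0 x; exists z.
by move=> d [x /[swap] H] /H [y [L _ yd]]; apply: lt_tr yd.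
Qed.

Lemma club_chain N (ltN : N -> N -> Prop) E : is_wellorder ltN ->
  (forall n, card_le {m | ltN m n} A) -> unbd lt E ->
  exists u : N -> W, (forall n, E (u n)) /\ forall m n, ltN m n -> lt (u m) (u n).
Proof.
move=> woN NA uE; have iW : inhabited W by case: rW.
have [u Hu] : exists u : N -> W, forall n, E (u n) /\ forall m, ltN m n -> lt (u m) (u n).
  refine (wf_choice (P := fun n (u : N -> W) v => E v /\ forall m, ltN m n -> lt (u m) v)
     (wo_wf woN) iW _ _).
    by move=> n u u' v EU [Ev H]; split=> // m mn; rewrite -(EU _ mn); apply: H.
  move=> n u; have [w Hw] := reg_bnd (fun m : {m | ltN m n} => u (proj1_sig m)) (NA n).
  have [v [Ev wv]] := uE w; exists v; split=> // m mn.
  exact: lt_tr (Hw (exist _ m mn)) wv.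
by exists u; split=> [n|m n]; [case: (Hu n)|case: (Hu n) => _; apply].
Qed.

(* Iterated refinement of clubs, in which [Ctr E] is meant to be a club
   witnessing that a construction performed with [E] does not guess clubs. *)
Lemma club_seq J (ltJ : J -> J -> Prop) (Ctr : (W -> Prop) -> W -> Prop) :
  is_wellorder ltJ -> (forall j, card_le {i | ltJ i j} A) ->
  (forall E, club lt E -> club lt (Ctr E)) ->
  exists Es : J -> W -> Prop, (forall j, club lt (Es j)) /\
    forall i j, ltJ i j -> forall x, Es j x -> Es i x /\ Ctr (Es i) x.
Proof.
move=> woJ JA cC.
have [Es HEs] : exists Es : J -> W -> Prop, forall j x,
    Es j x <-> forall i, ltJ i j -> Es i x /\ Ctr (Es i) x.
  refine (wf_choice (P := fun j (Es : J -> W -> Prop) (v : W -> Prop) => forall x,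
    v x <-> forall i, ltJ i j -> Es i x /\ Ctr (Es i) x) (wo_wf woJ) (inhabits (fun _ => True)) _ _).
    by move=> j u u' v EU H x; rewrite H; split=> H' i ij; move: (H' i ij); rewrite EU.
  by move=> j u; exists (fun x => forall i, ltJ i j -> u i x /\ Ctr (u i) x).
exists Es; split=> [j|i j ij x]; last by rewrite HEs => /(_ i ij).
elim: (wo_wf woJ j) => {}j _ IH.
have [cl ub] : club lt (fun x => forall i : {i | ltJ i j}, Es (proj1_sig i) x /\ Ctr (Es (proj1_sig i)) x).
  apply: (club_inter (JA j)) => -[i ij] /=; apply: club_inter2; first exact: IH.
  by apply: cC; apply: IH.
have EE x : Es j x <-> forall i : {i | ltJ i j}, Es (proj1_sig i) x /\ Ctr (Es (proj1_sig i)) x.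
  by rewrite HEs; split=> H; [move=> [i ij]; apply: H|move=> i ij; apply: (H (exist _ i ij))].
split=> [d ex H|x]; last by have [y [/EE Hy xy]] := ub x; exists y.
by apply/EE; apply: cl => // x /H [y [/EE Hy xy yd]]; exists y.
Qed.

End Regular.


Lemma cardinal_above M (ltM : M -> M -> Prop) : is_cardinal ltM -> card_le nat M ->
  forall x, exists y, ltM x y.
Proof.
move=> [wo cM] iM x; apply: NNPP => nx.
have Mo : card_le M (option {z | ltM z x}).
  apply: card_le_trans (nlt_le_option x wo).
  have H z : ~ ltM x z by move=> xz; apply: nx; exists z.
  by exists (fun z => exist _ z (H z)) => y z [->].
have [_] := cM x; apply; apply: (card_le_trans Mo); apply: option_le.
exact: option_infinite (card_le_trans iM Mo).
Qed.

Lemma empty_le A B : ~ inhabited A -> card_le A B.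
Proof.
move=> nA; exists (fun a => False_rect _ (nA (inhabits a))) => a.
by case: nA.
Qed.

(** * Singular cardinals *)

Definition Mk M (ltM : M -> M -> Prop) T (c : T -> M) k := {x | ltM x (c k)}.

(* [T] is the cofinality of the singular cardinal [M], [c] a cofinal map, [K]
   the successor of [M]. *)
Record setup M (ltM : M -> M -> Prop) K (ltK : K -> K -> Prop)
    T (ltT : T -> T -> Prop) (c : T -> M) : Prop := Setup {
  s_woM : is_wellorder ltM;
  s_regK : reg ltK M;
  s_woT : is_wellorder ltT;
  s_T_above : forall k, exists k', ltT k k';
  s_T_bnd : forall a (f : T -> T), exists k, forall x, ltT x a -> ltT (f x) k;
  s_T_large : forall P : T -> Prop, card_le T {x | P x} -> unbd ltT P;
  s_natT : card_le nat T;
  s_TMk : forall k, card_le T (Mk ltM c k);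
  s_c_mono : forall k k', ~ ltT k' k -> ~ ltM (c k') (c k);
  s_c_cof : forall x, exists k, ltM x (c k);
  s_Mk_small : forall k, ~ card_le M (Mk ltM c k);
  s_small : forall A, ~ card_le M A -> exists k, card_le A (Mk ltM c k);
  s_succ : forall A, card_le nat A -> card_le (A * A) A -> ~ card_le M A ->
    exists w, is_succ_card (fun x y : {x | ltK x w} => ltK (proj1_sig x) (proj1_sig y)) A /\
      ~ card_le M {x | ltK x w}
}.

(* The two consequences of [t] having size less than the cofinality [T] that
   are needed. *)
Definition sml K T (ltT : T -> T -> Prop) (t : K -> Prop) :=
  (forall u : K -> T, exists k, forall x, t x -> ltT (u x) k) /\ cov T t.

(** [T] is the least initial segment of [M] carrying a cofinal map [e], and [c k] is the least
    strict bound of [b] and of the values of [e] up to [k]. Thus [c] is nondecreasing and cofinal,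
    and every [Mk k] includes [T]. *)
Lemma setup_exists M (ltM : M -> M -> Prop) K (ltK : K -> K -> Prop) :
  singular_cardinal ltM -> is_succ_card ltK M ->
  exists T (ltT : T -> T -> Prop) (c : T -> M), setup ltM ltK ltT c /\
    forall X, card_lt_cf ltM X -> forall t : K -> Prop, card_le {x | t x} X -> sml ltT t.
Proof.
move=> [cM [iM [S [uS [SM nMS]]]]] sK.
have [wo cM'] := cM; have [woK [segK nKM]] := sK.
have upM := cardinal_above cM iM.
have MM := square_le wo iM.
have rK := succ_reg iM MM sK.
have [m0] : inhabited M by case: iM => f _; exact: (inhabits (f 0)).
pose cof b := exists e : M -> M, forall m, exists x, ltM x b /\ ~ ltM (e x) m.
have [b [[e He] bmin]] : exists b, cof b /\ forall b', cof b' -> ~ ltM b' b.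
  apply: ex_least => //.
  have iS : inhabited {x | S x} by have [y [Sy _]] := uS m0; constructor; exists y.
  case: (enum_dichotomy wo iS) => // -[w [e He]]; exists w, (fun x => proj1_sig (e x)).
  move=> m; have [y [Sy my]] := uS m; have [x [xw ex]] := He (exist _ y Sy).
  by exists x; rewrite ex.
have bndM a (f : M -> M) : ltM a b -> exists m, forall x, ltM x a -> ltM (f x) m.
  move=> ab; apply: NNPP => n; apply: (bmin a) ab; exists f => m; apply: NNPP => nx.
  apply: n; exists m => x xa; apply: NNPP => nf; apply: nx; by exists x.
pose T := {x | ltM x b}; pose ltT (x y : T) := ltM (proj1_sig x) (proj1_sig y).
have woT : is_wellorder ltT by exact: seg_wo.
have val_inj (x y : T) : proj1_sig x = proj1_sig y -> x = y.
  by case: x y => [x p] [y q] /= E; move: p q; rewrite E => p q; rewrite (proof_irrelevance _ p q).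
pose goodc (k : T) m := ltM b m /\ forall j : T, ~ ltT k j -> ltM (e (proj1_sig j)) m.
have up2 x y : exists z, ltM x z /\ ltM y z.
  have [z [zx [zy _]]] := ex_ub2 wo x y; have [w zw] := upM z; exists w.
  by split; apply: nlt_lt_tr zw.
have exc k : exists m, goodc k m.
  have [m Hm] := bndM _ e (proj2_sig k).
  have [z1 [mz1 ez1]] := up2 m (e (proj1_sig k)); have [z [zz bz]] := up2 z1 b.
  exists z; split=> // j /(nlt_tri woT) [<-|jk]; first exact: lt_tr zz.
  by apply: lt_tr zz => //; apply: lt_tr mz1 => //; apply: Hm.
pose c k := lmin ltM m0 (goodc k).
have cP k : goodc k (c k) by have [] := lmin_spec wo m0 (exc k).
have cmono k k' : ~ ltT k' k -> ~ ltM (c k') (c k).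
  move=> kk'; have [_ H] := lmin_spec wo m0 (exc k); apply: H.
  have [bc ec] := cP k'; split=> // j kj; apply: ec; exact: nlt_tr kj kk'.
have ccof x : exists k, ltM x (c k).
  have [y [yb ey]] := He x; exists (exist _ y yb).
  have [_ H] := cP (exist _ y yb); exact: nlt_lt_tr ey (H _ (@lt_irr _ _ woT _)).
have cb k : ltM b (c k) by have [] := cP k.
have bndTM a (f : T -> M) : exists m, forall x, ltT x a -> ltM (f x) m.
  have iT : inhabited T by constructor.
  have [g Hg] := @ac_in M T (fun x => ltM x b) (fun x y => proj1_sig y = x) iT
     (fun x xb => ex_intro _ (exist _ x xb) erefl).
  have [m Hm] := bndM _ (f \o g) (proj2_sig a).
  exists m => x xa; have := Hm _ xa; rewrite /= (val_inj (g _) x) //.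
  by apply: Hg; exact: (proj2_sig x).
have bndT a (f : T -> T) : exists k, forall x, ltT x a -> ltT (f x) k.
  have [m Hm] := bndTM a (c \o f); have [k mk] := ccof m; exists k => x xa.
  apply: NNPP => n; apply: (cmono _ _ n); exact: lt_tr (Hm _ xa) mk.
have upT k : exists k', ltT k k'.
  have [k' ck] := ccof (c k); exists k'; apply: NNPP => n; exact: (cmono _ _ n).
have [k0] : inhabited T by have [y [yb _]] := He m0; constructor; exists y.
have natT : card_le nat T.
  have [nx Hnx] := ac upT; exists (fun n => iter n nx k0).
  have mono m n : m < n -> ltT (iter m nx k0) (iter n nx k0).
    elim: n => // n IH; rewrite ltnS leq_eqVlt => /orP [/eqP ->|/IH L]; first exact: Hnx.
    exact: lt_tr L (Hnx _).
  move=> m n E; case: (ltngtP m n) => // /mono; rewrite E => L; by case: (lt_irr woT L).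
have TMk k : card_le T (Mk ltM c k).
  by apply: card_le_sig => x xb; apply: lt_tr xb (cb k).
have Mksmall k : ~ card_le M (Mk ltM c k) by have [] := cM' (c k).
have small A : ~ card_le M A -> exists k, card_le A (Mk ltM c k).
  move=> nA; case: (classic (inhabited A)) => [iA|/empty_le niA]; last by exists k0; apply: niA.
  case: (enum_dichotomy wo iA) => // -[w [g Hg]]; have [k wk] := ccof w; exists k.
  apply: (@card_le_trans _ {x | ltM x w}); last first.
    by apply: card_le_sig => x xw; apply: lt_tr wk.
  apply: surj_card_le; exists (fun x => g (proj1_sig x)) => a.
  by have [x [xw <-]] := Hg a; exists (exist _ x xw).
(* A bounded set of size [T] would embed [T] into one of its proper segments; [e] would then have
   its values indexed by that segment and be bounded, by minimality of [b]. *)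
have large (P : T -> Prop) : card_le T {x | P x} -> unbd ltT P.
  move=> TP a; apply: NNPP => n.
  have [a' aa'] := upT a.
  have Ta : card_le T {x | ltT x a'}.
    apply: card_le_trans TP _; apply: card_le_sig => x Px; apply: (nlt_lt_tr woT) aa'.
    by move=> ax; apply: n; exists x.
  have [|s Hs] := card_le_surj _ Ta; first exact: (inhabits k0).
  have [d] : inhabited {x | ltT x a'} by constructor; exists a.
  pose f (x : T) : M := e (proj1_sig (s (match excluded_middle_informative (ltT x a') with
     left p => exist (fun x => ltT x a') x p | right _ => d end))).
  have [m Hm] := bndTM a' f; have [y [yb ey]] := He m; apply: ey.
  have [x Hx] := Hs (exist _ y yb); have := Hm _ (proj2_sig x); rewrite /f.
  case: excluded_middle_informative => [p|[]]; last exact: (proj2_sig x).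
  have -> : exist (fun x => ltT x a') (proj1_sig x) p = x.
    by case: x {Hx} p => [x p] /= q; rewrite (proof_irrelevance _ p q).
  by rewrite Hx.
(* [w] is least with a segment of size greater than [A]. If that size were at least [M], then [T]
   and all [Mk k] would have size at most [A], and so would their union [M]. *)
have succ A : card_le nat A -> card_le (A * A) A -> ~ card_le M A ->
    exists w, is_succ_card (fun x y : {x | ltK x w} => ltK (proj1_sig x) (proj1_sig y)) A /\
      ~ card_le M {x | ltK x w}.
  move=> iA AA MA.
  have [w [nw wmin]] : exists w, ~ card_le {x | ltK x w} A /\
       forall y, ~ card_le {x | ltK x y} A -> ~ ltK y w.
    apply: ex_least => //; apply: NNPP => n.
    case: (enum_dichotomy woK (inhabits m0)) => // -[w [g Hg]].
    apply: n; exists w => wA; apply: MA; apply: card_le_trans wA.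
    apply: surj_card_le; exists (fun x => g (proj1_sig x)) => a.
    by have [x [xw <-]] := Hg a; exists (exist _ x xw).
  exists w.
  have sW : is_succ_card (fun x y : {x | ltK x w} => ltK (proj1_sig x) (proj1_sig y)) A.
    split; first exact: seg_wo; split=> // x.
    have [H _] := seg_seg_le x woK; apply: card_le_trans H _.
    by apply: NNPP => /wmin; apply; exact: (proj2_sig x).
  split=> // MW.
  have [woW [segW nWA]] := sW.
  have lt_le B : ~ card_le {x | ltK x w} B -> card_le B A.
    move=> nB; case: (classic (inhabited B)) => [iB|/empty_le niB]; last exact: niB.
    case: (enum_dichotomy woW iB) => // -[v [g Hg]].
    apply: card_le_trans (segW v).
    apply: surj_card_le; exists (fun x => g (proj1_sig x)) => a.
    by have [x [xw <-]] := Hg a; exists (exist _ x xw).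
  have TA : card_le T A.
    apply: lt_le => WT; apply: (Mksmall k0); apply: card_le_trans (TMk k0).
    exact: card_le_trans WT.
  have : cov A (fun x => exists k, ltM x (c k)).
    apply: cov_union => // k; apply: cov_of_le => //; apply: lt_le => WM.
    by apply: (Mksmall k); apply: card_le_trans WM.
  move=> [g Hg]; apply: MA; apply: surj_card_le; exists g => x.
  exact: Hg (ccof x).
exists T, ltT, c; split; first by split.
move=> X cX t tX; split.
  (* The values of [c] after [u] on [t] form a set of size at most [X], which is therefore not
     cofinal in [M]. *)
  move=> u; pose V m := exists x, t x /\ c (u x) = m.
  have VX : card_le {m | V m} X.
    apply: card_le_trans tX.
    have [g Hg] := @ac {m | V m} {x | t x} (fun m x => c (u (proj1_sig x)) = proj1_sig m)
      (fun m => let: ex_intro x (conj tx E) := proj2_sig m in ex_intro _ (exist _ x tx) E).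
    exists g => -[x px] [y py] E; have := Hg (exist _ x px); have := Hg (exist _ y py).
    rewrite -E => -> /= E'; move: px py {E}; rewrite E' => px py.
    by rewrite (proof_irrelevance _ px py).
  have [m Hm] := not_all_ex (cX V VX); have [k mk] := ccof m; exists k => x tx.
  apply: NNPP => n; apply: (cmono _ _ n); apply: lt_tr mk => //; apply: NNPP => n'.
  by apply: Hm; exists (c (u x)); split=> //; exists x.
have iK : inhabited K by case: rK.
apply: cov_of_le => //; apply: card_le_trans tX _.
case: (classic (inhabited X)) => [iX|/empty_le niX]; last exact: niX.
case: (enum_dichotomy woT iX) => [TX|[a [g Hg]]]; last first.
  by apply: surj_card_le; exists g => x; have [y [_ <-]] := Hg x; exists y.
(* With [T] embedded in [X], the range of [c] would be a cofinal set of size at most [X]. *)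
exfalso; apply: (cX (fun m => exists k, c k = m)).
  by apply: card_le_trans TX; apply: cov_le; exists c.
move=> x; have [k xk] := ccof x; exists (c k); split; first by exists k.
exact: lt_asym.
Qed.


(** * Club guessing *)

(* [eta] is nonzero and its cofinality exceeds the cardinality of [A]. *)
Definition big K (ltK : K -> K -> Prop) (A : Type) (eta : K) :=
  (exists z, ltK z eta) /\ forall u : A -> K, (forall a, ltK (u a) eta) ->
    exists b, ltK b eta /\ forall a, ltK (u a) b.

Lemma big_cov K (ltK : K -> K -> Prop) A eta V (P : V -> Prop) (f : V -> K) :
  big ltK A eta -> cov A P -> (forall x, P x -> ltK (f x) eta) ->
  exists b, ltK b eta /\ forall x, P x -> ltK (f x) b.
Proof.
move=> [[z zeta] H] [e He] Hf.
pose u a := if excluded_middle_informative (ltK (f (e a)) eta) then f (e a) else z.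
have [|b [bL Hb]] := H u; first by move=> a; rewrite /u; case: excluded_middle_informative.
exists b; split=> // x Px; have [a E] := He x Px; have := Hb a; rewrite /u E.
by case: excluded_middle_informative => // -[]; apply: Hf.
Qed.

Lemma chain_sup W (lt : W -> W -> Prop) N (ltN : N -> N -> Prop) (u : N -> W) :
  is_wellorder lt -> (forall n, exists m, ltN n m) -> (forall m n, ltN m n -> lt (u m) (u n)) ->
  (exists w, forall n, lt (u n) w) ->
  exists z, (forall n, lt (u n) z) /\ forall x, lt x z -> exists n, lt x (u n).
Proof.
move=> wo up mono /(ex_least wo) [z [Hz zmin]]; exists z; split=> // x xz.
apply: NNPP => n; apply: (zmin x) xz => m; apply: NNPP => nm; apply: n.
by have [m' mm'] := up m; exists m'; apply: nlt_lt_tr (mono _ _ mm').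
Qed.

Lemma chain_sup_in W (lt : W -> W -> Prop) N (u : N -> W) (E : W -> Prop) z :
  order_closed lt E -> inhabited N -> (forall n, E (u n)) -> (forall n, lt (u n) z) ->
  (forall x, lt x z -> exists n, lt x (u n)) -> E z.
Proof.
move=> cl [n0] Eu uz zu; apply: cl; first by exists (u n0).
by move=> x /zu [n xn]; exists (u n).
Qed.

Lemma chain_sup_big W (lt : W -> W -> Prop) N (ltN : N -> N -> Prop) A (u : N -> W) z :
  reg ltN A -> is_wellorder lt -> (forall m n, ltN m n -> lt (u m) (u n)) ->
  (forall n, lt (u n) z) -> (forall x, lt x z -> exists n, lt x (u n)) -> big lt A z.
Proof.
move=> rN wo mono uz zu; split; first by case: rN => _ [n] _ _ _; exists (u n).
move=> v vz; have [g Hg] := ac (R := fun a n => lt (v a) (u n)) (fun a => zu _ (vz a)).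
have [w Hw] := reg_bnd rN g (card_le_refl _); exists (u w); split=> // a.
by apply: lt_tr (mono _ _ (Hw a)).
Qed.

Section Guess.
Variables (M : Type) (ltM : M -> M -> Prop) (K : Type) (ltK : K -> K -> Prop).
Variables (T : Type) (ltT : T -> T -> Prop) (c : T -> M).
Hypothesis S : setup ltM ltK ltT c.
Notation Mk := (Mk ltM c).
Notation big := (big ltK).

Lemma s_woK : is_wellorder ltK.
Proof. by case: (s_regK S). Qed.

Lemma s_inhK : inhabited K.
Proof. by case: (s_regK S). Qed.

Lemma s_inhT : inhabited T.
Proof. by have [f _] := s_natT S; exact: (inhabits (f 0)). Qed.

Lemma s_Mk_le k : card_le (Mk k) M.
Proof. exact: card_le_proj. Qed.

Lemma s_Mk_nat k : card_le nat (Mk k).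
Proof. exact: card_le_trans (s_natT S) (s_TMk S k). Qed.

Lemma s_Mk_sq k : card_le (Mk k * Mk k) (Mk k).
Proof. exact: square_le (seg_wo _ (s_woM S)) (s_Mk_nat k). Qed.

Lemma s_T_sq : card_le (T * T) T.
Proof. exact: square_le (s_woT S) (s_natT S). Qed.

Lemma s_T_le : card_le T M.
Proof. by have [k] := s_inhT; apply: card_le_trans (s_TMk S k) (s_Mk_le k). Qed.

Lemma s_M_nat : card_le nat M.
Proof. exact: card_le_trans (s_natT S) s_T_le. Qed.

Lemma s_M_sq : card_le (M * M) M.
Proof. exact: square_le (s_woM S) s_M_nat. Qed.

Lemma s_small_le A : ~ card_le M A -> card_le A M.
Proof. by move=> nA; have [k H] := s_small S nA; apply: card_le_trans (s_Mk_le k). Qed.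

Lemma s_succ_reg A : card_le nat A -> card_le (A * A) A -> ~ card_le M A ->
  exists W (ltW : W -> W -> Prop), reg ltW A /\ ~ card_le M W.
Proof.
move=> iA AA nA; have [w [sW nW]] := s_succ S iA AA nA.
by exists {x | ltK x w}, (fun x y => ltK (proj1_sig x) (proj1_sig y)); split; first exact: succ_reg.
Qed.

(** Take the supremum of an increasing sequence from [E] whose length is the successor cardinal of
    [Mk k]. *)
Lemma exists_big E k : club ltK E -> exists z, E z /\ big (Mk k) z.
Proof.
move=> [cl ub].
have [W [ltW [rW nW]]] := s_succ_reg (s_Mk_nat k) (@s_Mk_sq k) (s_Mk_small S (k := k)).
have [woW iW _ _ segW] := rW.
have [u [Eu mono]] := club_chain (s_regK S) woW
  (fun n => card_le_trans (segW n) (s_Mk_le k)) ub.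
have [z [uz zu]] := chain_sup s_woK (reg_above rW) mono
  (reg_bnd (s_regK S) u (s_small_le nW)).
exists z; split; last exact: chain_sup_big rW s_woK mono uz zu.
exact: chain_sup_in cl iW Eu uz zu.
Qed.

Variable k0K : K.

Lemma exists_ladder : exists lad : forall k, K -> Mk k -> K, forall k eta,
  (exists z, ltK z eta) -> ~ big (Mk k) eta ->
  (forall a, ltK (lad k eta a) eta) /\ forall b, ltK b eta -> exists a, ~ ltK (lad k eta a) b.
Proof.
have H k : exists lad : K -> Mk k -> K, forall eta,
    (exists z, ltK z eta) -> ~ big (Mk k) eta ->
    (forall a, ltK (lad eta a) eta) /\ forall b, ltK b eta -> exists a, ~ ltK (lad eta a) b.
  apply: (ac (R := fun eta (u : Mk k -> K) => (exists z, ltK z eta) -> ~ big (Mk k) eta ->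
    (forall a, ltK (u a) eta) /\ forall b, ltK b eta -> exists a, ~ ltK (u a) b)) => eta.
  case: (classic ((exists z, ltK z eta) /\ ~ big (Mk k) eta)) => [[ez nb]|n]; last first.
    by exists (fun _ => k0K) => ez nb; case: n.
  have [u [ue nu]] : exists u : Mk k -> K, (forall a, ltK (u a) eta) /\
      ~ exists b, ltK b eta /\ forall a, ltK (u a) b.
    apply: NNPP => n; apply: nb; split=> // u ue; apply: NNPP => n'.
    by apply: n; exists u.
  exists u => _ _; split=> // b be; apply: NNPP => n; apply: nu; exists b; split=> // a.
  by apply: NNPP => n'; apply: n; exists a.
exists (fun k => proj1_sig (constructive_indefinite_description _ (H k))) => k.
by case: constructive_indefinite_description.
Qed.

Section Nodes.
Variable lad : forall k, K -> Mk k -> K.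
Hypothesis ladP : forall k eta,
  (exists z, ltK z eta) -> ~ big (Mk k) eta ->
  (forall a : Mk k, ltK (lad eta a) eta) /\ forall b, ltK b eta -> exists a : Mk k, ~ ltK (lad eta a) b.

(* The end point of the descent from [d] which at each step moves from [eta]
   to a point of a ladder of [eta] and then down to the closed set [E]. *)
Definition node (E : K -> Prop) k (d : K) (s : list (Mk k)) : K :=
  foldr (fun a eta => last_below ltK k0K E (lad eta a)) d s.

(* If no [E0] works, iterate the failures along [T^+].  The descent from [d]
   stabilises along the decreasing clubs, hence only visits points of their
   intersection, which by failure have cofinality at most [Mk k]; but then it
   can be steered down to a point of larger cofinality. *)
Lemma guess_nodes : exists E0, club ltK E0 /\ forall E, club ltK E ->
  exists d, forall k0, exists k, ~ ltT k k0 /\ exists s : list (Mk k),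
    [/\ E (node E0 d s), big (Mk k) (node E0 d s) & ~ ltK d (node E0 d s)].
Proof.
apply: NNPP => nG.
have [Ctr HC] : exists Ctr : (K -> Prop) -> K -> Prop, forall E0, club ltK E0 ->
    club ltK (Ctr E0) /\ forall d, exists k0, forall k, ~ ltT k k0 -> forall s : list (Mk k),
      Ctr E0 (node E0 d s) -> ~ ltK d (node E0 d s) -> ~ big (Mk k) (node E0 d s).
  apply: (ac_in (P := club ltK) (R := fun E0 E => club ltK E /\ forall d, exists k0, forall k,
      ~ ltT k k0 -> forall s : list (Mk k),
      E (node E0 d s) -> ~ ltK d (node E0 d s) -> ~ big (Mk k) (node E0 d s))).
    exact: (inhabits (fun _ => True)).
  move=> E0 cE0; apply: NNPP => n; apply: nG; exists E0; split=> // E cE.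
  apply: NNPP => n'; apply: n; exists E; split=> // d; apply: NNPP => n.
  apply: n'; exists d => k0; apply: NNPP => n'; apply: n; exists k0 => k kk0 s Es ds bs.
  by apply: n'; exists k; split=> //; exists s.
have nMT : ~ card_le M T.
  by have [k] := s_inhT => H; apply: (s_Mk_small S (k := k)); apply: card_le_trans (s_TMk S k).
have [J [ltJ [rJ nJ]]] := s_succ_reg (s_natT S) s_T_sq nMT.
have [woJ iJ _ _ segJ] := rJ.
have JM := s_small_le nJ.
have segJM j := card_le_trans (segJ j) s_T_le.
have [Es [cEs HEs]] := club_seq (s_regK S) woJ segJM (fun E cE => proj1 (HC E cE)).
pose E x := forall j, Es j x.
have cE : club ltK E := club_inter (s_regK S) JM cEs.
have [z Hz] := ac (fun k => exists_big k cE).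
have [d0 Hd0] := reg_bnd (s_regK S) z s_T_le.
have [_ ubE] := cE; have [d [Ed dd0]] := ubE d0.
have [kap Hkap] := ac (fun j => proj2 (HC _ (cEs j)) d).
(* [J] is regular and longer than [T], so some value [k] of the thresholds [kap j] recurs
   cofinally. *)
have [k Hk] : exists k, forall j0, exists j, ~ ltJ j j0 /\ kap j = k.
  apply: NNPP => n.
  have [f Hf] : exists f : T -> J, forall k j, ~ ltJ j (f k) -> kap j <> k.
    apply: (ac (R := fun k j0 => forall j, ~ ltJ j j0 -> kap j <> k)) => k.
    apply: NNPP => n'; apply: n; exists k => j0; apply: NNPP => n; apply: n'.
    by exists j0 => j jj0 E1; apply: n; exists j.
  have [j Hj] := reg_bnd rJ f (card_le_refl _).
  exact: (Hf (kap j) j (lt_asym woJ (Hj _))).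
have {}Hz := Hz k; have {}Hd0 := Hd0 k; set zk := z k in Hz Hd0.
have [Ezk bzk] := Hz.
(* The walk descends from [d] through points of [E] at or above [zk] at which the nodes agree for
   all large [j]; well-foundedness forbids it to go on for ever. *)
suff walk eta : (exists (s : list (Mk k)) j0, forall j, ~ ltJ j j0 -> node (Es j) d s = eta) ->
    E eta -> ~ ltK d eta -> ~ ltK eta zk -> False.
  have [j0] := iJ; apply: (walk d) => //; last exact: (lt_asym s_woK (lt_tr s_woK Hd0 dd0)).
    by exists [::], j0.
  exact: (@lt_irr _ _ s_woK).
elim: (wo_wf s_woK eta) => {}eta _ IH [s [j0 Hs]] Eeta de ez.
(* Belonging to the later club [Es j'] puts [eta] into [Ctr (Es j)], so the failure recorded at [j]
   denies [eta] a large cofinality. *)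
have [j [jj0 kj]] := Hk j0; have [j' jj'] := reg_above rJ j.
have [_ Cj] := HEs _ _ jj' _ (Eeta j').
have nb : ~ big (Mk k) eta.
  rewrite -(Hs j jj0); apply: (Hkap j); rewrite ?kj; first exact: (@lt_irr _ _ (s_woT S)).
    by rewrite Hs.
  by rewrite Hs.
case: (nlt_tri s_woK ez) => [E1|ze]; first by apply: nb; rewrite E1.
have [lade ladc] := ladP (ex_intro _ zk ze) nb.
(* A ladder point at or above [zk] is used: since [zk] lies in all the clubs, projecting to them
   does not fall below [zk]. *)
have [a za] := ladc _ ze; pose xi := lad eta a.
have [j1 Hj1] := antitone_stable (u := fun j => last_below ltK k0K (Es j) xi) s_woK woJ iJ
   (fun i j ij => last_anti s_woK (fun x Hx => proj1 (HEs _ _ ij x Hx))).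
have le_xi := @last_le _ _ k0K s_woK (Es j1) xi.
apply: (IH (last_below ltK k0K (Es j1) xi)).
- exact: (nlt_lt_tr s_woK le_xi (lade a)).
- have [j2 [j12 [j02 _]]] := ex_ub2 woJ j1 j0.
  exists (a :: s), j2 => i ij2; rewrite /= -/(node _ _ _) Hs -?/xi; first apply: Hj1.
    exact: (nlt_tr woJ j12 ij2).
  exact: (nlt_tr woJ j02 ij2).
- move=> i; have [j2 [ij2 j12]] := reg_ub2 rJ i j1.
  rewrite -(Hj1 j2); last exact: lt_asym.
  apply: (proj1 (HEs _ _ ij2 _ _)); apply: last_in; first exact: s_woK.
    by case: (cEs j2).
  by exists zk; split; first exact: Ezk.
- by apply: (nlt_tr s_woK _ de); apply: (lt_asym s_woK); exact: (nlt_lt_tr s_woK le_xi (lade a)).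
- exact: (last_ge s_woK (Ezk j1) za).
Qed.

End Nodes.

(** The [k]-th set of [b] consists of all nodes reached from the [k]-th piece of an enumeration of
    the points below [b]; there are only [Mk k] many finite lists. Once [d] has entered that piece,
    all nodes reached from [d] belong to the set, and the empty list yields the points
    themselves. *)
Lemma guess_sets : exists A : K -> T -> K -> Prop,
  [/\ forall b k, cov (Mk k) (A b k),
      forall i b, ltK i b -> exists k0, forall k, ~ ltT k k0 -> A b k i
    & forall E, club ltK E -> exists d (P : T -> K -> Prop),
       [/\ forall k eta, P k eta -> [/\ ~ ltK d eta, E eta & big (Mk k) eta],
           forall k0, exists k, ~ ltT k k0 /\ exists eta, P k eta
         & forall b, ltK d b -> exists k0, forall k, ~ ltT k k0 ->
              forall eta, P k eta -> A b k eta]].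
Proof.
have [lad ladP] := exists_ladder; have [E0 [cE0 HE0]] := guess_nodes ladP.
have [e He] := ac (R := fun b (e : M -> K) => forall x, ltK x b -> exists a, e a = x)
  (reg_seg_cov (s_regK S)).
pose B b k x := exists a, ltM a (c k) /\ e b a = x.
have Bex x b : ltK x b -> exists k0, forall k, ~ ltT k k0 -> B b k x.
  move=> /He [a Ea]; have [k0 ak0] := s_c_cof S a; exists k0 => k kk0; exists a; split=> //.
  exact: (lt_nlt_tr (s_woM S) ak0 (s_c_mono S kk0)).
exists (fun b k x => exists (s : list (Mk k)) d, B b k d /\ node lad E0 d s = x); split.
- move=> b k; apply: cov_union; [exact: s_inhK|exact: s_Mk_sq| |move=> s].
    exact: list_le (s_Mk_nat k) (@s_Mk_sq k).
  exists (fun a => node lad E0 (e b (proj1_sig a)) s) => x [d [[a [ak <-]] <-]].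
  by exists (exist _ a ak).
- by move=> x b /Bex [k0 H]; exists k0 => k kk0; exists [::], x; split=> //; apply: H.
move=> E cE; have [d Hd] := HE0 E cE.
exists d, (fun k eta => exists s : list (Mk k),
   [/\ node lad E0 d s = eta, E eta, big (Mk k) eta & ~ ltK d eta]); split.
- by move=> k eta [s []].
- move=> k0; have [k [kk0 [s [Es bs ds]]]] := Hd k0; exists k; split=> //.
  by exists (node lad E0 d s), s.
- move=> b /Bex [k0 H]; exists k0 => k kk0 eta [s [<- _ _ _]]; exists s, d; split=> //.
  exact: H.
Qed.

End Guess.


Lemma reg_le W (lt : W -> W -> Prop) A : reg lt A -> card_le A W.
Proof.
move=> rW; have [wo iW [f _] H segW] := rW.
have iA : inhabited A by constructor; exact: (f 0).
case: (enum_dichotomy wo iA) => [WA|[w [e He]]].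
  have [w Hw] := reg_bnd rW id WA; exfalso; exact: (@lt_irr _ _ wo w (Hw w)).
by apply: surj_card_le; exists e => a; have [x [_ <-]] := He a; exists x.
Qed.

Section ClubGuessing.
Variables (A N J W : Type).
Variables (ltN : N -> N -> Prop) (ltJ : J -> J -> Prop) (lt : W -> W -> Prop).
Hypotheses (rN : reg ltN A) (rJ : reg ltJ N) (rW : reg lt J).

Definition guesses (C : N -> W) (D : W -> Prop) :=
  [/\ forall n, D (C n), forall m n, ~ ltN n m -> ~ lt (C n) (C m)
    & forall n, exists m, ltN n m /\ lt (C n) (C m)].

(** Project ladders to a club [E]. If no [E] gives guesses, iterate the failures along [J]. As the
    clubs shrink each projected point goes down and stabilises, and since [J] is regular and longer
    than [N], all [N] coordinates have stabilised at a common stage. *)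
Lemma club_guessing : exists C : W * N -> N -> W,
  forall D, club lt D -> exists y, guesses (C y) D.
Proof.
have [woN iN _ _ segN] := rN; have [woJ iJ _ _ segJ] := rJ; have [wo [w0] _ _ _] := rW.
have NJ := reg_le rJ.
pose ladder (v : N -> W) a := [/\ forall m n, ltN m n -> lt (v m) (v n),
  forall n, lt (v n) a & forall x, lt x a -> exists n, lt x (v n)].
have [v Hv] : exists v : W -> N -> W, forall a, (exists u, ladder u a) -> ladder (v a) a.
  by apply: (ac_in (P := fun a => exists u, ladder u a) (R := fun a u => ladder u a)).
(* Indices below [n0] are raised to [n0], which keeps the whole ladder above a point common to all
   the clubs. *)
pose mx n n0 := if excluded_middle_informative (ltN n n0) then n0 else n.
pose C E (y : W * N) n := last_below lt w0 E (v y.1 (mx n y.2)).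
apply: NNPP => nG.
have [Ctr HC] : exists Ctr : (W -> Prop) -> W -> Prop, forall E, club lt E ->
    club lt (Ctr E) /\ forall y, ~ guesses (C E y) (Ctr E).
  apply: (ac_in (P := club lt) (R := fun E D => club lt D /\ forall y, ~ guesses (C E y) D)).
    exact: (inhabits (fun _ => True)).
  move=> E cE; apply: NNPP => n; apply: nG; exists (C E) => D cD; apply: NNPP => n'.
  by apply: n; exists D; split=> // y Hy; apply: n'; exists y.
have segJJ j := card_le_trans (segJ j) NJ.
have [Es [cEs HEs]] := club_seq rW woJ segJJ (fun E cE => proj1 (HC E cE)).
have [clE ubE] := club_inter rW (card_le_refl J) cEs.
have segNJ n := card_le_trans (segN n) (card_le_trans (reg_le rN) NJ).
have [u [Eu umono]] := club_chain rW woN segNJ ubE.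
have [a [ua au]] := chain_sup wo (reg_above rN) umono (reg_bnd rW u NJ).
have [vmono va av] : ladder (v a) a by apply: Hv; exists u; split.
have [nb] := iN; have [n0 Hn0] := av _ (ua nb).
have mxn n : ~ ltN (mx n n0) n.
  by rewrite /mx; case: excluded_middle_informative => L; [apply: (lt_asym woN)|exact: (@lt_irr _ _ woN)].
have mxn0 n : ~ ltN (mx n n0) n0.
  by rewrite /mx; case: excluded_middle_informative => // L; exact: (@lt_irr _ _ woN).
have mxmono m n : ~ ltN n m -> ~ ltN (mx n n0) (mx m n0).
  move=> nm; rewrite {2}/mx; case: excluded_middle_informative => L; first exact: mxn0.
  exact: (nlt_tr woN nm (@mxn n)).
have vmono' m n : ~ ltN n m -> ~ lt (v a n) (v a m).
  by move=> nm; case: (nlt_tri woN nm) => [->|/vmono /(lt_asym wo) //]; exact: (@lt_irr _ _ wo).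
have vu n : ~ lt (v a (mx n n0)) (u nb).
  by apply: (nlt_tr wo _ (vmono' _ _ (mxn0 n))); exact: (lt_asym wo Hn0).
have [jn Hjn] : exists jn : N -> J, forall n j, ~ ltJ j (jn n) ->
    C (Es j) (a, n0) n = C (Es (jn n)) (a, n0) n.
  apply: (ac (R := fun n j0 => forall j, ~ ltJ j j0 ->
    C (Es j) (a, n0) n = C (Es j0) (a, n0) n)) => n.
  apply: (antitone_stable (u := fun j => C (Es j) (a, n0) n) wo woJ iJ) => i j ij.
  by apply: (last_anti wo) => x Ex; case: (HEs _ _ ij x Ex).
(* After stage [js] nothing changes, so the points computed from [Es js] also come from [Es j1] and
   therefore lie in [Ctr (Es js)]. *)
have [js Hjs] := reg_bnd rJ jn (card_le_refl N); have [j1 js1] := reg_above rJ js.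
have [_ /(_ (a, n0))] := HC _ (cEs js); apply; split.
- move=> n; apply: (proj2 (HEs _ _ js1 _ _)).
  rewrite (Hjn n js (lt_asym woJ (Hjs n))) -(Hjn n j1 (lt_asym woJ (lt_tr woJ (Hjs n) js1))).
  apply: (@last_in _ _ w0 wo (Es j1) (v a (mx n n0))); first by case: (cEs j1).
  by exists (u nb); split; [exact: (Eu nb j1)|exact: vu].
- by move=> m n nm; apply: (last_mono wo); apply: vmono'; apply: mxmono.
- move=> n; have [m Hm] := au _ (va (mx n n0)); have [k Hk] := av _ (ua m).
  have [m1 [nm1 km1]] := reg_ub2 rN n k; exists m1; split=> //.
  have le1 := @last_le _ _ w0 wo (Es js) (v a (mx n n0)).
  apply: (nlt_lt_tr wo le1); apply: (lt_nlt_tr wo Hm).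
  apply: (last_ge wo (Eu m js)); apply: (nlt_tr wo (lt_asym wo Hk)).
  apply: vmono'; exact: (nlt_tr woN (lt_asym woN km1) (@mxn m1)).
Qed.

End ClubGuessing.


Lemma cov_or A W (P Q : W -> Prop) : inhabited W -> card_le nat A -> card_le (A * A) A ->
  cov A P -> cov A Q -> cov A (fun x => P x \/ Q x).
Proof.
move=> iW iA AA cP cQ.
apply: (cov_sub (P := fun x => exists b : bool, (if b then P else Q) x)).
  by move=> x [Px|Qx]; [exists true|exists false].
apply: cov_union => //; last by case.
by apply: card_le_trans iA; exists (fun b : bool => b : nat) => -[] [].
Qed.

Lemma cov_sing A W (x : W) : inhabited A -> cov A (fun y => y = x).
Proof. by move=> [a]; exists (fun _ => x) => _ ->; exists a. Qed.

(** Choose an index for each of the at most [A] many values; beyond a bound of these indices a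
    nondecreasing sequence can only repeat one value. *)
Lemma monotone_stable N (ltN : N -> N -> Prop) A W (lt : W -> W -> Prop) (q : N -> W) :
  reg ltN A -> is_wellorder lt -> (forall m n, ltN m n -> ~ lt (q n) (q m)) ->
  cov A (fun x => exists n, q n = x) ->
  exists n0, forall n, ~ ltN n n0 -> q n = q n0.
Proof.
move=> rN wo mono [e He]; have [woN iN _ _ _] := rN.
have [nn Hnn] : exists nn : A -> N, forall a, (exists n, q n = e a) -> q (nn a) = e a.
  by apply: (ac_in (P := fun a => exists n, q n = e a) (R := fun a n => q n = e a)).
have [n0 Hn0] := reg_bnd rN nn (card_le_refl _); exists n0 => n /(nlt_tri woN) [->//|n0n].
have [a Ea] := He (q n) (ex_intro _ n erefl).
have E : q (nn a) = q n by rewrite Hnn // Ea; exists n.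
apply: (nlt_anti wo); first exact: mono.
by rewrite -E; apply: mono.
Qed.

(** * Scales *)

Section Scale.
Variables (M : Type) (ltM : M -> M -> Prop) (K : Type) (ltK : K -> K -> Prop).
Variables (T : Type) (ltT : T -> T -> Prop) (c : T -> M).
Hypothesis S : setup ltM ltK ltT c.
Notation Mk := (Mk ltM c).
Notation big := (big ltK).
Let woK : is_wellorder ltK := s_woK S.
Let iK : inhabited K := s_inhK S.

Lemma s_Mk_mono k k' : ~ ltT k' k -> card_le (Mk k) (Mk k').
Proof.
move=> kk'; apply: card_le_sig => x xk; exact: (lt_nlt_tr (s_woM S) xk (s_c_mono S kk')).
Qed.

Lemma s_Mk_inh k : inhabited (Mk k).
Proof. by have [f _] := s_Mk_nat S k; constructor; exact: (f 0). Qed.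

Definition ev (P : T -> Prop) := exists k, forall i, ~ ltT i k -> P i.

Lemma ev_sub (P Q : T -> Prop) : ev P -> (forall i, P i -> Q i) -> ev Q.
Proof. by move=> [k Hk] PQ; exists k => i /Hk /PQ. Qed.

Lemma ev_and (P Q : T -> Prop) : ev P -> ev Q -> ev (fun i => P i /\ Q i).
Proof.
move=> [k Hk] [k' Hk']; have [z [zk [zk' _]]] := ex_ub2 (s_woT S) k k'; exists z => i iz.
by split; [apply: Hk; exact: (nlt_tr (s_woT S) zk iz)|apply: Hk'; exact: (nlt_tr (s_woT S) zk' iz)].
Qed.

Lemma ev_ge k : ev (fun i => ~ ltT i k).
Proof. by exists k. Qed.

Lemma succ_bound k : exists m, big (Mk k) m /\ exists l, card_le {x | ltK x m} (Mk l).
Proof.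
have [w [sW nW]] := s_succ S (s_Mk_nat S k) (s_Mk_sq S k) (s_Mk_small S (k := k)).
have [woW [y] _ bW _] := succ_reg (s_Mk_nat S k) (s_Mk_sq S k) sW.
exists w; split; last exact: (s_small S nW).
split; first by exists (proj1_sig y); exact: (proj2_sig y).
move=> u uw; have [b Hb] := bW (fun a => exist _ (u a) (uw a)).
by exists (proj1_sig b); split; [exact: (proj2_sig b)|exact: Hb].
Qed.

Definition small_club (d : K) (E : K -> Prop) := [/\ forall x, E x -> ltK x d,
  exists k, cov (Mk k) E, forall x, ltK x d -> exists y, E y /\ ltK x y
  & forall z, ltK z d -> (exists x, ltK x z) ->
      (forall x, ltK x z -> exists y, [/\ E y, ltK x y & ltK y z]) -> E z].

(* Every [f d] bounds, beyond some coordinate, the pointwise supremum of the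
   [f b] for [b] in some fixed small club [Ed d] of [d]. *)
Lemma exists_increasing (m : T -> K) : (forall k, big (Mk k) (m k)) ->
  exists (f : K -> T -> K) (Ed : K -> K -> Prop),
  [/\ forall d i, ltK (f d i) (m i),
      forall a b, ltK a b -> ev (fun i => ltK (f a i) (f b i)),
      forall d, (exists E, small_club d E) -> small_club d (Ed d)
    & forall d, (exists E, small_club d E) ->
        ev (fun i => forall b, Ed d b -> ltK (f b i) (f d i))].
Proof.
move=> bm; have [k0] := s_inhK S.
have [Ed HEd] : exists Ed : K -> K -> Prop, forall d, (exists E, small_club d E) -> small_club d (Ed d).
  apply: (ac_in (P := fun d => exists E, small_club d E) (R := fun d E => small_club d E)) => //.
  exact: (inhabits (fun _ => True)).
have [e He] := ac (R := fun b (e : M -> K) => forall x, ltK x b -> exists a, e a = x)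
  (reg_seg_cov (s_regK S)).
pose B d k b := ltK b d /\ ((exists a, ltM a (c k) /\ e d a = b) \/ (Ed d b /\ cov (Mk k) (Ed d))).
have cB d k : cov (Mk k) (B d k).
  apply: (cov_sub (P := fun b => (exists a, ltM a (c k) /\ e d a = b) \/ (Ed d b /\ cov (Mk k) (Ed d)))).
    by move=> b [].
  apply: (cov_or iK (s_Mk_nat S k) (s_Mk_sq S k)).
    by exists (fun a => e d (proj1_sig a)) => b [a [ak <-]]; exists (exist _ a ak).
  case: (classic (cov (Mk k) (Ed d))) => [[g Hg]|n]; last by exists (fun _ => k0) => b [].
  by exists g => b [/Hg].
have [f Hf] : exists f : K -> T -> K, forall d, (forall b i, ltK b d -> ltK (f b i) (m i)) ->
    forall i, ltK (f d i) (m i) /\ forall b, B d i b -> ltK (f b i) (f d i).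
  refine (wf_choice (P := fun d (f : K -> T -> K) v => (forall b i, ltK b d -> ltK (f b i) (m i)) ->
    forall i, ltK (v i) (m i) /\ forall b, B d i b -> ltK (f b i) (v i)) (wo_wf woK) _ _ _).
  - exact: (inhabits (fun _ => k0)).
  - move=> d u u' v EU H Hu i; case: (H _ i) => [b j bd|vm Hv]; first by rewrite EU //; apply: Hu.
    by split=> // b Bb; rewrite -EU; [apply: Hv|case: Bb].
  - move=> d u; case: (classic (forall b i, ltK b d -> ltK (u b i) (m i))) => [Hu|n]; last first.
      by exists (fun _ => k0) => /n.
    have [v Hv] := ac (fun i => big_cov (f := fun b => u b i) (bm i) (cB d i)
       (fun b Bb => Hu b i (proj1 Bb))).
    by exists v.
have fm d i : ltK (f d i) (m i).
  by elim: (wo_wf woK d) i => {}d _ IH i; have [] := Hf d (fun b j bd => IH b bd j) i.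
have fB d i b : B d i b -> ltK (f b i) (f d i).
  by have [_ H] := Hf d (fun b j _ => fm b j) i; apply: H.
exists f, Ed; split=> //.
  move=> a b ab; have [x Ex] := He b a ab; have [k xk] := s_c_cof S x; exists k => i ik.
  apply: fB; split=> //; left; exists x; split=> //.
  exact: (lt_nlt_tr (s_woM S) xk (s_c_mono S ik)).
move=> d /HEd [Edd [k ck] _ _]; exists k => i ik b Eb; apply: fB; split; first exact: Edd.
by right; split=> //; apply: (cov_trans iK (s_Mk_mono ik)).
Qed.

Variables (k0K : K) (m : T -> K) (f : K -> T -> K) (Ed : K -> K -> Prop).
Hypothesis fm : forall d i, ltK (f d i) (m i).
Hypothesis f_mono : forall a b, ltK a b -> ev (fun i => ltK (f a i) (f b i)).
Hypothesis EdP : forall d, (exists E, small_club d E) -> small_club d (Ed d).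
Hypothesis f_Ed : forall d, (exists E, small_club d E) ->
  ev (fun i => forall b, Ed d b -> ltK (f b i) (f d i)).

Definition proj (X : T -> K -> Prop) (u : T -> K) (i : T) : K :=
  lmin ltK k0K (fun y => X i y /\ ~ ltK y (u i)).

(** As [m i] exceeds every [f a i], this guarantees that projections of the [f a] to [X] exist. *)
Definition eub_set (X : T -> K -> Prop) := forall i, X i (m i).

Lemma projP X a i : eub_set X ->
  [/\ X i (proj X (f a) i), ~ ltK (proj X (f a) i) (f a i)
    & forall y, X i y -> ~ ltK y (f a i) -> ~ ltK y (proj X (f a) i)].
Proof.
move=> mX; have ex : exists y, X i y /\ ~ ltK y (f a i).
  by exists (m i); split; [exact: mX|apply: (lt_asym woK); exact: fm].
have [[Xp pf] pmin] := lmin_spec woK k0K ex; split=> // y Xy yf.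
by apply: pmin.
Qed.

(* If the projections kept growing, choose a continuous sequence [x] of length
   [Mk k ^+++] along which they do, so that a bound [f v] of an initial segment
   of a guessed set occurs before the next point of it whenever there is one.
   The chosen club of the supremum [d] of [x] provides such bounds on a guessed
   set [C y].  The projections of the suprema of [f] over the initial segments
   of [C y] increase within a set of size [Mk k], hence stabilise, although the
   projections of [f] along [C y] do not. *)
Lemma proj_stable k (X : T -> K -> Prop) : eub_set X -> (forall i, cov (Mk k) (X i)) ->
  exists a0, forall a, ev (fun i => ~ ltK (proj X (f a0) i) (f a i)).
Proof.
move=> mX cX.
suff [a0 Ha0] : exists a0, forall a, ~ ltK a a0 -> ev (fun i => ~ ltK (proj X (f a0) i) (f a i)).
  exists a0 => a; case: (classic (ltK a a0)) => [aa0|]; last exact: Ha0.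
  apply: ev_sub (f_mono aa0) _ => i L.
  have [_ H _] := projP a0 i mX; exact: (nlt_tr woK (lt_asym woK L) H).
apply: NNPP => nst.
have {}nst a0 : exists a, ~ ltK a a0 /\ ~ ev (fun i => ~ ltK (proj X (f a0) i) (f a i)).
  apply: NNPP => n; apply: nst; exists a0 => a aa0; apply: NNPP => n'.
  by apply: n; exists a.
(* [N], [J] and [W] are the three successor cardinals after [Mk k], as club guessing demands; all
   are still smaller than [M]. *)
have [N [ltN [rN nN]]] := s_succ_reg S (s_Mk_nat S k) (s_Mk_sq S k) (s_Mk_small S (k := k)).
have [woN iN _ _ _] := rN; have iN' := card_le_trans (s_Mk_nat S k) (reg_le rN).
have [J [ltJ [rJ nJ]]] := s_succ_reg S iN' (square_le woN iN') nN.
have [woJ iJ _ _ _] := rJ; have iJ' := card_le_trans iN' (reg_le rJ).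
have [W [lt [rW nW]]] := s_succ_reg S iJ' (square_le woJ iJ') nJ.
have [wo [w0] _ _ segW] := rW.
have [C HC] := club_guessing rN rJ rW.
have WM := s_small_le S nW; have NM := s_small_le S nN.
have segM s : card_le {t | lt t s} M := card_le_trans (segW s) (s_small_le S nJ).
pose star (u : W -> K) s := lmin ltK k0K (fun y => forall t, lt t s -> ltK (u t) y).
have starP u s : (forall t, lt t s -> ltK (u t) (star u s)) /\
    forall y, (forall t, lt t s -> ltK (u t) y) -> ~ ltK y (star u s).
  apply: (lmin_spec woK).
  have [y Hy] := reg_bnd (s_regK S) (fun t : {t | lt t s} => u (proj1_sig t)) (segM s).
  by exists y => t ts; exact: (Hy (exist _ t ts)).
(* [f v] bounds [f] at all points given by [C y] up to index [n], with a single threshold in [T] for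
   all of them. *)
pose hle (u : W -> K) (y : W * N) n v :=
  ev (fun i => forall n', ~ ltN n n' -> ~ ltK (f v i) (f (star u (C y n')) i)).
pose below s y n := forall n', ~ ltN n n' -> ~ lt s (C y n').
have [xi Hxi] : exists xi : W -> K, forall s,
    [/\ forall t, lt t s -> ltK (xi t) (xi s),
        forall y n, below s y n -> (exists v, hle xi y n v) -> hle xi y n (xi s)
      & ~ ev (fun i => ~ ltK (proj X (f (star xi s)) i) (f (xi s) i))].
  refine (wf_choice (P := fun s (u : W -> K) v =>
    [/\ forall t, lt t s -> ltK (u t) v,
        forall y n, below s y n -> (exists v, hle u y n v) -> hle u y n v
      & ~ ev (fun i => ~ ltK (proj X (f (star u s)) i) (f v i))]) (wo_wf wo) iK _ _).
    move=> s u u' v EU [H1 H2 H3].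
    have starE t : ~ lt s t -> star u t = star u' t.
      move=> st; rewrite /star; congr lmin; apply: functional_extensionality => y.
      have E' r : lt r t -> u r = u' r by move=> rt; apply: EU; exact: (lt_nlt_tr wo rt st).
      by apply: propositional_extensionality; split=> H r rt; have := H r rt; rewrite E'.
    have hleE y n w : below s y n -> hle u y n w <-> hle u' y n w.
      move=> Hb; split=> -[l Hl]; exists l => i il n' nn'; have := Hl i il n' nn'; rewrite starE //;
      exact: Hb.
    split.
    - by move=> t ts; rewrite -EU //; apply: H1.
    - move=> y n Hb [w Hw]; apply/hleE => //; apply: H2 => //; exists w.
      by apply/hleE.
    - by rewrite -starE //; exact: (@lt_irr _ _ wo).
  move=> s u.
  (* There are at most [M] many pairs of [y] and [n], so one [v] can exceed a bound for each of them
     as well as a point [a1] at which the projection fails to be an upper bound. *)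
  have [sg Hsg] : exists sg : (W * N) * N -> K, forall p,
      (exists v, hle u p.1 p.2 v) -> hle u p.1 p.2 (sg p).
    by apply: (ac_in (P := fun p => exists v, hle u p.1 p.2 v) (R := fun p v => hle u p.1 p.2 v)).
  have [b1 Hb1] := reg_bnd (s_regK S) sg (card_le_trans (card_le_pair (card_le_trans
    (card_le_pair WM NM) (s_M_sq S)) NM) (s_M_sq S)).
  have [a1 [sa1 na1]] := nst (star u s).
  have [b2 [b12 a12]] := reg_ub2 (s_regK S) b1 a1.
  have [v [bv sv]] := reg_ub2 (s_regK S) b2 (star u s).
  exists v; split.
  - by move=> t ts; apply: (lt_tr woK _ sv); apply: (proj1 (starP u s)).
  - move=> y n _ H; have Hy := Hsg (y, n) H.
    have L : ltK (sg (y, n)) v by apply: (lt_tr woK (Hb1 _)); exact: (lt_tr woK b12 bv).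
    apply: ev_sub (ev_and Hy (f_mono L)) _ => i [H1 H2] n' nn'.
    exact: (nlt_tr woK (H1 n' nn') (lt_asym woK H2)).
  - move=> H; apply: na1; have L : ltK a1 v := lt_tr woK a12 bv.
    apply: ev_sub (ev_and H (f_mono L)) _ => i [H1 H2].
    exact: (nlt_tr woK (lt_asym woK H2) H1).
pose x s := star xi s.
have xi_lt s t : lt s t -> ltK (xi s) (x t) by case: (starP xi t) => H _; apply: H.
have x_le s : ~ ltK (xi s) (x s).
  by case: (starP xi s) => _; apply; case: (Hxi s).
have x_mono s t : lt s t -> ltK (x s) (x t) by move=> /xi_lt; apply: (nlt_lt_tr woK).
have x_inv s t : ltK (x s) (x t) -> lt s t.
  move=> L; apply: NNPP => n; case: (nlt_tri wo n) => [E|/x_mono /(lt_asym woK)]; last exact.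
  by move: L; rewrite E; exact: (@lt_irr _ _ woK).
have [d [xd dx]] := chain_sup woK (reg_above rW) x_mono (reg_bnd (s_regK S) x WM).
have exE : exists E, small_club d E.
  exists (fun z => exists s, x s = z); split.
  - by move=> _ [s <-].
  - by have [l Hl] := s_small S nW; exists l; apply: (cov_trans iK Hl); exists x.
  - by move=> z /dx [s zs]; exists (x s); split=> //; exists s.
  move=> z zd [y0 yz] zlim; have [s0 zs0] := dx z zd.
  have [s [zs smin]] := ex_least wo (ex_intro (fun s => ~ ltK (x s) z) s0 (lt_asym woK zs0)).
  exists s; apply: (nlt_anti woK) => //.
  case: (starP xi s) => _; apply=> t ts.
  have tz : ltK (x t) z by apply: NNPP => n; exact: (smin t).
  have [_ [[t' <-] tt' t'z]] := zlim _ tz.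
  exact: (lt_tr woK (xi_lt _ _ (x_inv _ _ tt')) t'z).
have [Edd _ Edub Edcl] := EdP exE.
have [phi Hphi] : exists phi : W -> W, forall s, exists e, [/\ Ed d e, ltK (x s) e & ltK e (x (phi s))].
  apply: (ac (R := fun s t => exists e, [/\ Ed d e, ltK (x s) e & ltK e (x t)])) => s.
  have [e [Ee se]] := Edub _ (xd s); have [t et] := dx _ (Edd _ Ee).
  by exists t, e.
have [y [yD ymono ytop]] := HC _ (closure_club rW phi).
have xEd s : closure_pts lt phi s -> Ed d (x s).
  move=> [[r rs] Hs]; apply: Edcl => //; first by exists (x r); apply: x_mono.
  move=> z zs; have [t [ts zt]] : exists t, lt t s /\ ~ ltK (xi t) z.
    apply: NNPP => n; case: (starP xi s) => _ /(_ z) H; apply: H zs => t ts.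
    by apply: NNPP => n'; apply: n; exists t.
  have tphi : lt t (phi t).
    by have [e [_ te ep]] := Hphi t; apply: x_inv; exact: (lt_tr woK te ep).
  have [e [Ee pe ep]] := Hphi (phi t); exists e; split=> //.
    exact: (lt_tr woK (nlt_lt_tr woK zt (xi_lt _ _ tphi)) pe).
  by apply: (lt_tr woK ep); apply: x_mono; exact: (Hs _ (Hs _ ts)).
have [k1 Hk1] := f_Ed exE.
have hd n' i : ~ ltT i k1 -> ltK (f (x (C y n')) i) (f d i).
  by move=> ik; apply: (Hk1 i ik); apply: xEd; apply: yD.
(* [f d] dominates [f] on [Ed d] with one threshold, so a bound exists and [xi (C y n)] was chosen
   to be one. *)
have hC n : hle xi y n (xi (C y n)).
  have [_ H _] := Hxi (C y n); apply: H; first by move=> n' nn'; apply: ymono.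
  exists d, k1 => i ik n' _; apply: (lt_asym woK); exact: hd.
pose q n i := lmin ltK k0K (fun z => X i z /\ forall n', ~ ltN n n' -> ~ ltK z (f (x (C y n')) i)).
have qP n i : ~ ltT i k1 -> [/\ X i (q n i), forall n', ~ ltN n n' -> ~ ltK (q n i) (f (x (C y n')) i)
   & forall z, X i z -> (forall n', ~ ltN n n' -> ~ ltK z (f (x (C y n')) i)) -> ~ ltK z (q n i)].
  move=> ik; have ex : exists z, X i z /\ forall n', ~ ltN n n' -> ~ ltK z (f (x (C y n')) i).
    exists (m i); split=> [|n' _]; first exact: mX.
    by apply: (lt_asym woK); exact: fm.
  have [[Xq Hq] qmin] := lmin_spec woK k0K ex; split=> // z Xz Hz.
  exact: qmin.
have [ni Hni] : exists ni : T -> N, forall i, ~ ltT i k1 -> forall n, ~ ltN n (ni i) -> q n i = q (ni i) i.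
  apply: (ac_in (P := fun i => ~ ltT i k1) (R := fun i n0 => forall n, ~ ltN n n0 -> q n i = q n0 i)) => //.
  move=> i ik; apply: (monotone_stable (q := fun n => q n i) rN woK).
    move=> n1 n2 n12; have [_ _ qmin] := qP n1 i ik; have [Xq Hq _] := qP n2 i ik.
    apply: qmin => // n' nn'; apply: Hq; exact: (nlt_tr woN nn' (lt_asym woN n12)).
  apply: (cov_sub (P := X i)) (cX i) => z [n <-].
  by case: (qP n i ik).
have [ns Hns] := reg_bnd rN ni (s_TMk S k).
have [n1 [nn1 C1]] := ytop ns; have [n2 [nn2 C2]] := ytop n1.
(* Growth at [C y n1] is contradicted: eventually [f (xi (C y n1)) i] lies below [q n2 i], which
   equals [q ns i] and so is at most the projection. *)
have [_ _] := Hxi (C y n1); apply.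
have L1 := f_mono (xi_lt _ _ C1); have L2 := f_mono (xi_lt _ _ C2).
apply: ev_sub (ev_and (ev_and (hC ns) L1) (ev_and L2 (ev_ge k1))) _ => i [[H1 H2] [H3 ik]].
have [Xp pf pmin] := projP (star xi (C y n1)) i mX.
have [_ _ qmin] := qP ns i ik; have [_ Hq _] := qP n2 i ik.
have qn2 : q n2 i = q ns i.
  rewrite (Hni i ik n2) ?(Hni i ik ns) //; apply: (lt_asym woN); first exact: Hns.
  exact: (lt_tr woN (Hns i) (lt_tr woN nn1 nn2)).
have Q1 : ~ ltK (proj X (f (star xi (C y n1))) i) (q ns i).
  apply: qmin => // n' nn'; apply: (nlt_tr woK (H1 n' nn')).
  exact: (nlt_tr woK (lt_asym woK H2) pf).
apply: (nlt_tr woK _ Q1); rewrite -qn2.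
apply: (nlt_tr woK (lt_asym woK H3)); apply: Hq; exact: (@lt_irr _ _ woN).
Qed.

Definition upper (u : T -> K) := forall a, ev (fun i => ~ ltK (u i) (f a i)).

Lemma proj_upper k (X : T -> K -> Prop) : eub_set X -> (forall i, cov (Mk k) (X i)) ->
  exists a0, upper (proj X (f a0)).
Proof. by move=> mX cX; have [a0 H] := proj_stable mX cX; exists a0. Qed.

Lemma f_lt_ex a : exists b, ltK a b.
Proof. exact: reg_above (s_regK S) a. Qed.

(* Otherwise [T^+] upper bounds [U j] arise, none of them above the projection
   to the earlier ones.  For one large [f a] these projections decrease with [j],
   so all coordinates are constant from some [j] on, a contradiction. *)
Lemma exists_lub : exists g, [/\ forall i, ~ ltK (m i) (g i), upper g
  & forall u, upper u -> ev (fun i => ~ ltK (u i) (g i))].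
Proof.
apply: NNPP => nL; have [k] := s_inhT S.
have nMT : ~ card_le M T.
  by move=> H; apply: (s_Mk_small S (k := k)); apply: (card_le_trans H (s_TMk S k)).
have [J [ltJ [rJ nJ]]] := s_succ_reg S (s_natT S) (s_T_sq S) nMT.
have [woJ iJ _ _ segJ] := rJ; have JM := s_small_le S nJ.
pose X (U : J -> T -> K) j i y := y = m i \/ exists j', ltJ j' j /\ y = U j' i.
have mX U j : eub_set (X U j) by move=> i; left.
have cX U j i : cov (Mk k) (X U j i).
  apply: (cov_or iK (s_Mk_nat S k) (s_Mk_sq S k)); first exact: cov_sing (s_Mk_inh k).
  apply: (cov_trans iK (card_le_trans (segJ j) (s_TMk S k))).
  exists (fun p : {j' | ltJ j' j} => U (proj1_sig p) i) => y [j' [jj ->]].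
  by exists (exist _ j' jj).
have [U HU] : exists U : J -> T -> K, forall j, upper (U j) /\
    exists a, ~ ev (fun i => ~ ltK (U j i) (proj (X U j) (f a) i)).
  refine (wf_choice (P := fun j (U : J -> T -> K) v => upper v /\
    exists a, ~ ev (fun i => ~ ltK (v i) (proj (X U j) (f a) i))) (wo_wf woJ) _ _ _).
  - exact: (inhabits (fun _ => k0K)).
  - move=> j u u' v EU [uv [a Ha]]; split=> //; exists a.
    suff -> : X u' j = X u j by [].
    apply: functional_extensionality => i; apply: functional_extensionality => y.
    apply: propositional_extensionality.
    by split=> -[|[j' [jj ->]]]; [left|right; exists j'; rewrite EU|left|right; exists j'; rewrite EU].
  - move=> j u; have [a Ha] := proj_upper (mX u j) (cX u j).
    apply: NNPP => n; apply: nL; exists (proj (X u j) (f a)); split=> // [i|v uv].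
      by have [_ _ H] := projP a i (mX u j); apply: H; [exact: mX|apply: (lt_asym woK); exact: fm].
    by apply: NNPP => n'; apply: n; exists v; split=> //; exists a.
have [al Hal] := ac (fun j => proj2 (HU j)).
have [a Ha] := reg_bnd (s_regK S) al JM.
pose G j i := proj (X U j) (f a) i.
have [ji Hji] : exists ji : T -> J, forall i j, ~ ltJ j (ji i) -> G j i = G (ji i) i.
  apply: (ac (R := fun i j0 => forall j, ~ ltJ j j0 -> G j i = G j0 i)) => i.
  apply: (antitone_stable (u := fun j => G j i) woK woJ iJ) => j j' jj'.
  have [XG Gf _] := projP a i (mX U j); have [_ _ H] := projP a i (mX U j'); apply: H => //.
  move: XG; rewrite -/(G j i) => -[->|[j2 [j2j ->]]]; [left|right] => //; exists j2; split=> //.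
  exact: (lt_tr woJ j2j jj').
have [js Hjs] := reg_bnd rJ ji (card_le_refl _); have [j1 js1] := reg_above rJ js.
apply: (Hal js); have [uU _] := HU js.
apply: ev_sub (ev_and (f_mono (Ha js)) (uU a)) _ => i [L1 L2].
have [XG Gf _] := projP a i (mX U js); have [_ _ Hp] := projP (al js) i (mX U js).
have L3 : ~ ltK (G js i) (proj (X U js) (f (al js)) i).
  by apply: Hp => //; exact: (nlt_tr woK (lt_asym woK L1) Gf).
apply: (nlt_tr woK L3).
have -> : G js i = G j1 i.
  by rewrite (Hji i js (lt_asym woJ (Hjs i))) (Hji i j1 (lt_asym woJ (lt_tr woJ (Hjs i) js1))).
have [_ _ H] := projP a i (mX U j1); apply: H => //.
by right; exists js.
Qed.

End Scale.

Section ScaleExists.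
Variables (M : Type) (ltM : M -> M -> Prop) (K : Type) (ltK : K -> K -> Prop).
Variables (T : Type) (ltT : T -> T -> Prop) (c : T -> M).
Hypothesis S : setup ltM ltK ltT c.
Notation Mk := (Mk ltM c).
Notation big := (big ltK).
Notation ev := (ev ltT).
Let woK : is_wellorder ltK := s_woK S.

(** [g] is a least eventual upper bound, so every projection that is an upper bound is eventually at
    least [g]. Projecting to [u i] shows that the part of [u] below [g] is eventually below some
    [f a]; projecting to a ladder of [g i] indexed by [Mk k] shows that [g i] has larger cofinality
    for all large [i]. *)
Lemma exists_scale : exists (f : K -> T -> K) (g : T -> K),
  [/\ forall a b, ltK a b -> ev (fun i => ltK (f a i) (f b i)),
      forall a, ev (fun i => ltK (f a i) (g i)),
      forall u : T -> K, exists a, ev (fun i => ltK (u i) (g i) -> ltK (u i) (f a i)),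
      forall k, ev (fun i => big (Mk k) (g i))
    & forall i, exists l, card_le {x | ltK x (g i)} (Mk l)].
Proof.
have [k0K] := s_inhK S.
have [m Hm] := ac (succ_bound S).
have bm k := proj1 (Hm k); have sm k := proj2 (Hm k).
have [f [Ed [fm f_mono EdP f_Ed]]] := exists_increasing S bm.
have [g [gm ug gl]] := exists_lub S k0K fm f_mono EdP f_Ed.
have fg a : ev (fun i => ltK (f a i) (g i)).
  have [b ab] := f_lt_ex S a.
  apply: ev_sub (ev_and S (f_mono _ _ ab) (ug b)) _ => i [L1 L2].
  exact: (lt_nlt_tr woK L1 L2).
exists f, g; split=> //.
- move=> u; have [k] := s_inhT S; pose X i y := y = m i \/ y = u i.
  have mX : eub_set m X by move=> i; left.
  have cX i : cov (Mk k) (X i).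
    by apply: (cov_or (s_inhK S) (s_Mk_nat S k) (s_Mk_sq S k)); exact: cov_sing (s_Mk_inh S k).
  have [a Ha] := proj_upper S k0K fm f_mono EdP f_Ed mX cX; exists a.
  apply: ev_sub (gl _ Ha) _ => i H ug'; apply: NNPP => n.
  have [_ _ pmin] := projP S k0K fm a i mX.
  by apply: (pmin (u i)) => //; [right|exact: (lt_nlt_tr woK ug' H)].
- move=> k; have [lad ladP] := exists_ladder ltM ltK c k0K.
  pose X i y := y = m i \/ (~ big (Mk k) (g i) /\ exists a : Mk k, lad k (g i) a = y).
  have mX : eub_set m X by move=> i; left.
  have cX i : cov (Mk k) (X i).
    apply: (cov_or (s_inhK S) (s_Mk_nat S k) (s_Mk_sq S k)); first exact: cov_sing (s_Mk_inh S k).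
    by apply: (cov_sub (P := fun y => exists a : Mk k, lad k (g i) a = y)) (cov_img _) => y [].
  have [a Ha] := proj_upper S k0K fm f_mono EdP f_Ed mX cX.
  apply: ev_sub (ev_and S (gl _ Ha) (fg a)) _ => i [H L]; apply: NNPP => nb.
  have [ladl ladc] := ladP _ _ (ex_intro _ _ L) nb; have [b Hb] := ladc _ L.
  have [_ _ pmin] := projP S k0K fm a i mX.
  apply: (pmin (lad k (g i) b)) => //; first by right; split=> //; exists b.
  exact: (lt_nlt_tr woK (ladl b) H).
- move=> i; have [l Hl] := sm i; exists l; apply: card_le_trans Hl; apply: card_le_sig => x xg.
  exact: (lt_nlt_tr woK xg (gm i)).
Qed.

End ScaleExists.


(** * Rectangles *)

Section Rectangles.
Variables (M : Type) (ltM : M -> M -> Prop) (K : Type) (ltK : K -> K -> Prop).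
Variables (T : Type) (ltT : T -> T -> Prop) (c : T -> M).
Hypothesis S : setup ltM ltK ltT c.
Notation Mk := (Mk ltM c).
Notation big := (big ltK).
Notation ev := (ev ltT).
Let woK : is_wellorder ltK := s_woK S.
Let woT : is_wellorder ltT := s_woT S.

(* Thinning the coordinates makes the cofinality of [g i] exceed the size of all
   earlier [g j]. *)
Lemma exists_thin_scale : exists (f : K -> T -> K) (g : T -> K) (l : T -> T),
  [/\ forall a b, ltK a b -> ev (fun i => ltK (f a i) (f b i)),
      forall a i, ltK (f a i) (g i),
      forall u : T -> K, exists a, ev (fun i => ltK (u i) (g i) -> ltK (u i) (f a i)),
      forall i, big (Mk (l i)) (g i)
    & forall i j, ltT j i -> card_le {x | ltK x (g j)} (Mk (l i))].
Proof.
have [f [g [f_mono fg f_ex g_big g_small]]] := exists_scale S.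
have [ls Hls] := ac g_small.
have [tau Htau] : exists tau : T -> T, forall a, (forall b, ltT b a -> ltT (tau b) (tau a)) /\
    exists l, (forall b, ltT b a -> card_le {x | ltK x (g (tau b))} (Mk l)) /\
      forall i, ~ ltT i (tau a) -> big (Mk l) (g i).
  refine (wf_choice (P := fun a (u : T -> T) v => (forall b, ltT b a -> ltT (u b) v) /\
    exists l, (forall b, ltT b a -> card_le {x | ltK x (g (u b))} (Mk l)) /\
      forall i, ~ ltT i v -> big (Mk l) (g i)) (wo_wf woT) (s_inhT S) _ _).
    move=> a u u' v EU [H [l [Hl bl]]]; split=> [b ba|]; first by rewrite -EU //; apply: H.
    by exists l; split=> // b ba; rewrite -EU //; apply: Hl.
  move=> a u; have [k1 Hk1] := s_T_bnd S a u; have [l Hl] := s_T_bnd S a (ls \o u).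
  have [v0 Hv0] := g_big l; have [v [k1v [v0v _]]] := ex_ub2 woT k1 v0.
  exists v; split=> [b ba|]; first exact: (lt_nlt_tr woT (Hk1 b ba) k1v).
  exists l; split=> [b ba|i iv]; last by apply: Hv0; exact: (nlt_tr woT v0v iv).
  apply: (card_le_trans (Hls _)); apply: (s_Mk_mono S).
  exact: (lt_asym woT (Hl b ba)).
have [l Hl] := ac (fun a => proj2 (Htau a)).
have tau_mono a b : ltT a b -> ltT (tau a) (tau b) by case: (Htau b) => H _; apply: H.
have tau_inj a b : tau a = tau b -> a = b.
  by move=> E; apply: (nlt_anti woT) => /tau_mono; rewrite E; apply: (@lt_irr _ _ woT).
have tau_ge a : ~ ltT (tau a) a.
  elim: (wo_wf woT a) => {}a _ IH L; exact: (IH _ L (tau_mono _ _ L)).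
have ev_tau P : ev P -> ev (fun i => P (tau i)).
  move=> [k Hk]; exists k => i ik; apply: Hk; exact: (nlt_tr woT ik (@tau_ge i)).
have bigt i : big (Mk (l i)) (g (tau i)).
  by have [_ H] := Hl i; apply: H; exact: (@lt_irr _ _ woT).
have [z Hz] := ac (fun i => proj1 (bigt i)).
(* Values not below [g (tau i)] occur only at a bounded set of coordinates; replacing them by [z i]
   makes the bound hold everywhere. *)
pose f' a i := if excluded_middle_informative (ltK (f a (tau i)) (g (tau i))) then f a (tau i) else z i.
have f'g a i : ltK (f' a i) (g (tau i)).
  by rewrite /f'; case: excluded_middle_informative => //= _; apply: Hz.
have f'E a : ev (fun i => f' a i = f a (tau i)).
  apply: ev_sub (ev_tau _ (fg a)) _ => i /= L.
  by rewrite /f'; case: excluded_middle_informative.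
exists f', (fun i => g (tau i)), l; split=> //.
- move=> a b ab; apply: ev_sub (ev_and S (ev_and S (f'E a) (f'E b)) (ev_tau _ (f_mono a b ab))) _.
  by move=> i [[-> ->]].
- move=> u; have [v Hv] : exists v : T -> K, forall i b, tau b = i -> v i = u b.
    apply: (ac (R := fun i y => forall b, tau b = i -> y = u b)) => i.
    case: (classic (exists b, tau b = i)) => [[b <-]|n].
      by exists (u b) => b' /tau_inj ->.
    by have [y] := s_inhK S; exists y => b Eb; case: n; exists b.
  have [a Ha] := f_ex v; exists a.
  apply: ev_sub (ev_and S (f'E a) (ev_tau _ Ha)) _ => i [-> ].
  by rewrite (Hv _ i erefl).
- by move=> i j ji; have [H _] := Hl i; apply: H.
Qed.

Lemma sml_ev (t : K -> Prop) (P : K -> T -> Prop) : sml ltT t ->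
  (forall b, t b -> ev (P b)) -> ev (fun i => forall b, t b -> P b i).
Proof.
move=> [bt _] H.
have [k Hk] : exists k : K -> T, forall b, t b -> forall i, ~ ltT i (k b) -> P b i.
  apply: (ac_in (P := t) (R := fun b k => forall i, ~ ltT i k -> P b i)) => //.
  exact: (s_inhT S).
have [k0 Hk0] := bt k; exists k0 => i ik b tb; apply: Hk => //.
exact: (nlt_tr woT (lt_asym woT (Hk0 _ tb)) ik).
Qed.

Definition unbounded_family (t : K -> K -> Prop) (U : K -> Prop) :=
  forall e, exists x, U x /\ forall a, t x a -> ltK e a.

(** [h a b] is the last coordinate at which [f b] is below [f a]. To realize a large [i], choose a
    member of the family whose [f a i] exceed all [f b i]; at later coordinates [f a] is bounded by
    a fixed function [chi], which lies eventually below every [f b]. *)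
Lemma rectangle_coloring : exists h : K -> K -> T, forall (t : K -> K -> Prop) (U : K -> Prop),
  (forall x, U x -> sml ltT (t x)) -> unbounded_family t U ->
  exists e, forall s : K -> Prop, sml ltT s -> (forall b, s b -> ltK e b) ->
    ev (fun i => exists x, [/\ U x, forall a, t x a -> ltK a e
                              & forall a b, t x a -> s b -> h a b = i]).
Proof.
have [f [g [l [f_mono fg f_ex g_big g_small]]]] := exists_thin_scale.
pose hP a b i := ltK (f b i) (f a i) /\ forall j, ltT i j -> ~ ltK (f b j) (f a j).
have [h Hh] : exists h : K -> K -> T, forall a b i, hP a b i -> h a b = i.
  exists (fun a b => epsilon (s_inhT S) (hP a b)) => a b i Hi.
  have [H1 H2] := epsilon_spec (s_inhT S) (hP a b) (ex_intro _ i Hi); case: Hi => H3 H4.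
  by apply: (nlt_anti woT) => L; [apply: (H2 _ L)|apply: (H4 _ L)].
exists h => t U tU uU.
(* Otherwise [u] collects counterexamples; some [f a1] eventually exceeds them, and a member of the
   family above [a1] refutes them at all large coordinates. *)
have [a0 Ha0] : ev (fun i => forall z, ltK z (g i) -> exists x, U x /\ forall a, t x a -> ltK z (f a i)).
  apply: NNPP => nE.
  pose bad i z := ltK z (g i) /\ forall x, U x -> exists a, t x a /\ ~ ltK z (f a i).
  have [u Hu] : exists u : T -> K, forall i, (exists z, bad i z) -> bad i (u i).
    apply: (ac_in (P := fun i => exists z, bad i z) (R := fun i z => bad i z)) => //.
    exact: (s_inhK S).
  have [a1 Ha1] := f_ex u; have [x [Ux Hx]] := uU a1.
  have E1 := sml_ev (tU _ Ux) (fun b tb => f_mono _ _ (Hx b tb)).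
  apply: nE; apply: ev_sub (ev_and S Ha1 E1) _ => i [H1 H2] z zg.
  apply: NNPP => n.
  have [ug Hb] : bad i (u i).
    apply: Hu; exists z; split=> // y Uy; apply: NNPP => n'; apply: n; exists y; split=> // a ta.
    by apply: NNPP => n; apply: n'; exists a.
  have [a [ta]] := Hb _ Ux; apply; exact: (lt_tr woK (H1 ug) (H2 _ ta)).
have [xs Hxs] : exists xs : T -> K -> K, forall i z, ~ ltT i a0 -> ltK z (g i) ->
    U (xs i z) /\ forall a, t (xs i z) a -> ltK z (f a i).
  apply: (ac (R := fun i (v : K -> K) => forall z, ~ ltT i a0 -> ltK z (g i) ->
    U (v z) /\ forall a, t (v z) a -> ltK z (f a i))) => i.
  apply: (ac (R := fun z x => ~ ltT i a0 -> ltK z (g i) ->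
    U x /\ forall a, t x a -> ltK z (f a i))) => z.
  case: (classic (~ ltT i a0 /\ ltK z (g i))) => [[ia zg]|n].
    by have [x Hx] := Ha0 i ia z zg; exists x.
  by exists z => ia zg; case: n.
pose V i a := ~ ltT i a0 /\ exists z, ltK z (g i) /\ t (xs i z) a.
have covV B i : card_le nat B -> card_le (B * B) B -> card_le T B -> card_le {x | ltK x (g i)} B ->
    cov B (V i).
  move=> nB BB TB gB; case: (classic (ltT i a0)) => [ia|ia].
    have [k0] := s_inhK S; have [b _] := nB; exists (fun _ => k0) => a [] //.
  apply: (cov_sub (P := fun a => exists z : {z | ltK z (g i)}, t (xs i (proj1_sig z)) a)).
    by move=> a [_ [z [zg ta]]]; exists (exist _ z zg).
  apply: (cov_union (s_inhK S) BB gB) => -[z zg] /=.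
  have [Ux _] := Hxs i z ia zg; have [_ ct] := tU _ Ux.
  exact: (cov_trans (s_inhK S) TB ct).
(* By the thinning, the cofinality of [g j] exceeds the size of the union of the [V i] with [i]
   below [j]. *)
have [chi Hchi] : exists chi : T -> K, forall j, ltK (chi j) (g j) /\
    forall a, (exists i, ltT i j /\ V i a) -> ltK (f a j) (chi j).
  apply: (ac (R := fun j y => ltK y (g j) /\
    forall a, (exists i, ltT i j /\ V i a) -> ltK (f a j) y)) => j.
  apply: (big_cov (f := fun a => f a j) (g_big j)) => [|a _]; last exact: fg.
  apply: (cov_sub (P := fun a => exists i : {i | ltT i j}, V (proj1_sig i) a)).
    by move=> a [i [ij Va]]; exists (exist _ i ij).
  apply: (cov_union (s_inhK S) (s_Mk_sq S _)) => [|[i ij] /=].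
    by apply: card_le_trans (s_TMk S (l j)); apply: card_le_proj.
  apply: covV; [exact: (s_Mk_nat S)|exact: (s_Mk_sq S)|exact: (s_TMk S)|exact: g_small].
have [a1 Ha1] := f_ex chi.
have [e1 He1] : exists e, forall a, (exists i, V i a) -> ltK a e.
  have [||e He] := @reg_bnd_cov _ _ _ (s_regK S) M _ (fun a => exists i, V i a) id.
  - apply: (cov_union (s_inhK S) (s_M_sq S) (s_T_le S)) => i.
    apply: covV; [exact: (s_M_nat S)|exact: (s_M_sq S)|exact: (s_T_le S)|].
    by case: (s_regK S).
  - exact: card_le_refl.
  by exists e.
have [e [e1e a1e]] := reg_ub2 (s_regK S) e1 a1.
exists e => s ss se.
have E1 := sml_ev ss (fun b sb => f_mono _ _ (lt_tr woK a1e (se b sb))).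
have [k1 Hk1] := E1; have [k2 Hk2] := Ha1.
have [k [k1k [k2k _]]] := ex_ub2 woT k1 k2.
apply: ev_sub (ev_and S (ev_ge _ a0) (ev_ge _ k)) _ => i [ia ik].
have [z [zg Hz]] : exists z, ltK z (g i) /\ forall b, s b -> ltK (f b i) z.
  apply: (big_cov (f := fun a => f a i) (g_big i)) => [|a _]; last exact: fg.
  by have [_ cs] := ss; exact: (cov_trans (s_inhK S) (s_TMk S _) cs).
have [Ux Hx] := Hxs i z ia zg.
exists (xs i z); split=> // [a ta|a b ta sb].
  by apply: (lt_tr woK _ e1e); apply: He1; exists i; split=> //; exists z.
apply: Hh; split; first exact: (lt_tr woK (Hz b sb) (Hx a ta)).
move=> j ij; apply: (lt_asym woK); have [chig chiP] := Hchi j.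
have jk : ~ ltT j k by apply: (lt_asym woT); exact: (nlt_lt_tr woT ik ij).
apply: (lt_tr woK (chiP a _)); first by exists i; split=> //; split=> //; exists z.
apply: (lt_tr woK (Hk2 j (nlt_tr woT k2k jk) chig)).
exact: (Hk1 j (nlt_tr woT k1k jk) b sb).
Qed.

End Rectangles.


(** * From rectangles to squares *)

Section Transformation.
Variables (M : Type) (ltM : M -> M -> Prop) (K : Type) (ltK : K -> K -> Prop).
Variables (T : Type) (ltT : T -> T -> Prop) (c : T -> M).
Hypothesis S : setup ltM ltK ltT c.
Notation Mk := (Mk ltM c).
Notation big := (big ltK).
Notation ev := (ev ltT).
Notation unbounded_family := (unbounded_family ltK).
Let woK : is_wellorder ltK := s_woK S.
Let woT : is_wellorder ltT := s_woT S.

Lemma sml_sing x : sml ltT (fun a : K => a = x).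
Proof.
split; last exact: cov_sing (s_inhT S).
by move=> u; have [k Hk] := s_T_above S (u x); exists k => _ ->.
Qed.

(** Each pair is taken at [T] many coordinates, and a set of size [T] is cofinal in [T]. *)
Lemma exists_pairing : exists pi : T -> T * T, forall p i, exists j, pi j = p /\ ltT i j.
Proof.
have [i0] := s_inhT S.
have [|s Hs] := @card_le_surj T (T * T * T) (inhabits (i0, i0, i0)).
  apply: card_le_trans (s_T_sq S); apply: card_le_pair (card_le_refl _).
  exact: (s_T_sq S).
exists (fun j => (s j).1) => p i.
have [j Hj] := ac (R := fun r j => s j = (p, r)) (fun r => Hs (p, r)).
have : card_le T {j | (s j).1 = p}.
  have Hp r : (s (j r)).1 = p by rewrite Hj.
  exists (fun r => exist _ (j r) (Hp r)) => r r' [E]; have := Hj r; rewrite E Hj.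
  by case.
by move=> /(s_T_large S) /(_ i) [j' [? ?]]; exists j'.
Qed.

Variables (k0K : K) (A : K -> T -> K -> Prop).
Hypothesis A_cov : forall b k, cov (Mk k) (A b k).
Hypothesis A_all : forall i b, ltK i b -> exists k0, forall k, ~ ltT k k0 -> A b k i.
Hypothesis A_guess : forall E, club ltK E -> exists d (P : T -> K -> Prop),
  [/\ forall k eta, P k eta -> [/\ ~ ltK d eta, E eta & big (Mk k) eta],
      forall k0, exists k, ~ ltT k k0 /\ exists eta, P k eta
    & forall b, ltK d b -> exists k0, forall k, ~ ltT k k0 ->
        forall eta, P k eta -> A b k eta].

(** If all guessed [eta] failed, each subfamily would have a bound; since [eta] is at most [d],
    these bounds have a common bound. A member [t x] beyond it and beyond [d] and [iota] is small,
    so from one [k] on its sets contain the guessed points and [iota], contradicting the bound. *)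
Lemma attach (t : K -> K -> Prop) (U : K -> Prop) (iota : K) (E : K -> Prop) :
  (forall x, U x -> sml ltT (t x)) -> unbounded_family t U -> club ltK E ->
  exists eta k, [/\ E eta, big (Mk k) eta, ltK iota eta &
    unbounded_family t (fun x => U x /\ forall b, t x b -> [/\ ltK eta b, A b k eta & A b k iota])].
Proof.
move=> tU uU cE.
have [d [P [HP exP PA]]] := A_guess (club_inter2 (s_regK S) cE (club_tail (s_regK S) iota)).
pose Q eta k x := U x /\ forall b, t x b -> [/\ ltK eta b, A b k eta & A b k iota].
apply: NNPP => n.
have [bd Hbd] : exists bd : T -> K -> K, forall k eta, ~ unbounded_family t (Q eta k) ->
    ~ exists x, Q eta k x /\ forall a, t x a -> ltK (bd k eta) a.
  apply: (ac (R := fun k (bd : K -> K) => forall eta, ~ unbounded_family t (Q eta k) ->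
    ~ exists x, Q eta k x /\ forall a, t x a -> ltK (bd eta) a)) => k.
  apply: (ac_in (P := fun eta => ~ unbounded_family t (Q eta k))
    (R := fun eta e => ~ exists x, Q eta k x /\ forall a, t x a -> ltK e a)).
    exact: (s_inhK S).
  by move=> eta H; apply: not_all_ex.
have [d' dd'] := reg_above (s_regK S) d.
have [w Hw] := ac (fun k => reg_bnd_lt (s_regK S) d' (bd k)).
have [e1 He1] := reg_bnd (s_regK S) w (s_T_le S).
have [e2 [e12 de2]] := reg_ub2 (s_regK S) e1 d.
have [e [e2e ie]] := reg_ub2 (s_regK S) e2 iota.
have [x [Ux Hx]] := uU e.
have [k0 Hk0] : ev (fun k => forall b, t x b -> (forall eta, P k eta -> A b k eta) /\ A b k iota).
  apply: (sml_ev S (P := fun b k => (forall eta, P k eta -> A b k eta) /\ A b k iota) (tU _ Ux)) => b tb.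
  have eb := Hx b tb.
  apply: (ev_and S (P := fun k => forall eta, P k eta -> A b k eta)).
    exact: PA (lt_tr woK de2 (lt_tr woK e2e eb)).
  exact: A_all (lt_tr woK ie eb).
have [k [kk0 [eta Pk]]] := exP k0; have [de [Ee ieta] be] := HP k eta Pk.
have nQ : ~ unbounded_family t (Q eta k).
  by move=> H; apply: n; exists eta, k.
apply: (Hbd k eta nQ); exists x; split.
  split=> // b tb; have [H1 H2] := Hk0 k kk0 b tb; split=> //; last exact: H1.
  exact: (nlt_lt_tr woK de (lt_tr woK de2 (lt_tr woK e2e (Hx b tb)))).
move=> b tb; apply: (lt_tr woK (Hw k eta _)); first exact: (nlt_lt_tr woK de dd').
exact: (lt_tr woK (He1 k) (lt_tr woK e12 (lt_tr woK e2e (Hx b tb)))).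
Qed.

(** The least strict bound of the points below [eta] in the sets [A b k] with [b] in [s]. If such a
    set contains [eta], then [eta] is its first point at or above any point from the gap up to
    [eta]. *)
Definition gap k eta (s : K -> Prop) :=
  lmin ltK k0K (fun y => forall b xi, s b -> A b k xi -> ltK xi eta -> ltK xi y).

Lemma gapP k eta s b xi : s b -> A b k xi -> ltK xi eta -> ltK xi (gap k eta s).
Proof.
have [H _] := @lmin_spec _ _ woK k0K
  (fun y => forall b xi, s b -> A b k xi -> ltK xi eta -> ltK xi y)
  (ex_intro _ eta (fun _ _ _ _ L => L)).
exact: H.
Qed.

Lemma gap_lt k eta s : big (Mk k) eta -> sml ltT s -> ltK (gap k eta s) eta.
Proof.
move=> be [_ cs].
have [|b [bL Hb]] := big_cov (P := fun xi => (exists b : {b | s b}, A (proj1_sig b) k xi) /\ ltK xi eta)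
   (f := id) be _ (fun x Px => proj2 Px).
  apply: (cov_sub (P := fun xi => exists b : {b | s b}, A (proj1_sig b) k xi)); first by move=> x [].
  apply: (cov_union (s_inhK S) (s_Mk_sq S k)) => [|[b sb]]; last exact: A_cov.
  exact: (card_le_trans (cov_le cs) (s_TMk S k)).
have [_ H] := @lmin_spec _ _ woK k0K
  (fun y => forall b xi, s b -> A b k xi -> ltK xi eta -> ltK xi y)
  (ex_intro _ eta (fun _ _ _ _ L => L)).
apply: (nlt_lt_tr woK _ bL); apply: H => b' xi sb Ab xe; apply: Hb; split=> //.
by exists (exist _ b' sb).
Qed.

Definition attached (t : K -> K -> Prop) (U : K -> Prop) iota k eps eta x :=
  [/\ U x, forall b, t x b -> [/\ ltK eta b, A b k eta & A b k iota] & gap k eta (t x) = eps].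

(** Pressing down: given a club against every [eps] and [k], attach the family to a point [eta] of
    their diagonal intersection. The gap of a member lies below [eta], so it is one of the refuted
    [eps]. *)
Lemma attach_stationary (t : K -> K -> Prop) (U : K -> Prop) (iota : K) :
  (forall x, U x -> sml ltT (t x)) -> unbounded_family t U ->
  exists k eps, forall E, club ltK E -> exists eta,
    [/\ E eta, ltK eps eta, ltK iota eta & unbounded_family t (attached t U iota k eps eta)].
Proof.
move=> tU uU; apply: NNPP => n.
have [E HE] : exists E : K -> T -> K -> Prop, forall eps k, club ltK (E eps k) /\
    forall eta, E eps k eta -> ltK eps eta -> ltK iota eta ->
      ~ unbounded_family t (attached t U iota k eps eta).
  apply: (ac (R := fun eps (E : T -> K -> Prop) => forall k, club ltK (E k) /\
    forall eta, E k eta -> ltK eps eta -> ltK iota eta ->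
      ~ unbounded_family t (attached t U iota k eps eta))) => eps.
  apply: (ac (R := fun k (E : K -> Prop) => club ltK E /\
    forall eta, E eta -> ltK eps eta -> ltK iota eta ->
      ~ unbounded_family t (attached t U iota k eps eta))) => k.
  apply: NNPP => n'; apply: n; exists k, eps => E cE; apply: NNPP => n.
  by apply: n'; exists E; split=> // eta Ee L1 L2 H; apply: n; exists eta.
have cD := club_diag (s_regK S) (fun eps => club_inter (s_regK S) (s_T_le S)
   (fun k => proj1 (HE eps k))).
have [eta [k [De be ie uQ]]] := attach iota tU uU cD.
have [bd Hbd] : exists bd : K -> K, forall eps, ltK eps eta ->
    ~ exists x, attached t U iota k eps eta x /\ forall a, t x a -> ltK (bd eps) a.
  apply: (ac_in (P := fun eps => ltK eps eta) (R := fun eps e =>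
    ~ exists x, attached t U iota k eps eta x /\ forall a, t x a -> ltK e a)).
    exact: (s_inhK S).
  move=> eps ee; apply: not_all_ex; have [_ H] := HE eps k; exact: (H _ (De _ ee k) ee ie).
have [w Hw] := reg_bnd_lt (s_regK S) eta bd.
have [x [[Ux Qx] Hx]] := uQ w.
have ge := gap_lt be (tU _ Ux).
apply: (Hbd _ ge); exists x; split; first by split.
by move=> a ta; exact: (lt_tr woK (Hw _ ge) (Hx a ta)).
Qed.

Definition next_above k a b := lmin ltK k0K (fun xi => A b k xi /\ ~ ltK xi a).

Lemma next_aboveE k a b xi : A b k xi -> ~ ltK xi a ->
  (forall z, A b k z -> ltK z xi -> ltK z a) -> next_above k a b = xi.
Proof.
move=> Ab xa H; apply: (lmin_unique woK) => // z [Az za] zx.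
by apply: za; apply: H.
Qed.

Lemma transform (cc : K -> K -> K) :
  (forall X : K -> Prop, card_le K {x : K | X x} ->
     forall g, exists a b, X a /\ X b /\ ltK a b /\ cc a b = g) ->
  exists G : K -> K -> K, forall (t : K -> K -> Prop) (U : K -> Prop),
    (forall x, U x -> sml ltT (t x)) -> unbounded_family t U -> forall g,
    exists x y, [/\ U x, U y, forall a b, t x a -> t y b -> ltK a b
                  & forall a b, t x a -> t y b -> G a b = g].
Proof.
move=> Hcc; have [h Hh] := rectangle_coloring S; have [pi Hpi] := exists_pairing.
exists (fun a b => let: (k1, k2) := pi (h a b) in
  let b2 := next_above k1 a b in let b1 := next_above k2 a b2 in
  let e := gap k2 b1 (fun z => z = b2) in
  let a2 := next_above k1 e a in let a1 := next_above k2 e a2 in cc a1 b1).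
move=> t U tU uU g.
(* Here the extra point [iota] is the dummy [k0K]. In the second attachment it is [e1], which forces
   [e1] below [e2]. *)
have [k1 [e1 H1]] := attach_stationary k0K tU uU.
pose U1 eta x := attached t U k0K k1 e1 eta x.
pose S1 eta := ltK e1 eta /\ unbounded_family t (U1 eta).
pose sing (x : K) := fun a : K => a = x.
have uS1 : unbounded_family sing S1.
  move=> e; have [eta [ee L _ H]] := H1 _ (club_tail (s_regK S) e).
  by exists eta; split=> // a ->.
have [k2 [e2 H2]] := attach_stationary e1 (fun x _ => sml_sing x) uS1.
pose U2 eta x := attached sing S1 e1 k2 e2 eta x.
pose S2 eta := [/\ ltK e2 eta, ltK e1 eta & unbounded_family sing (U2 eta)].
pose U3 eta x := exists eta', U2 eta eta' /\ U1 eta' x.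
have sU3 eta x : U3 eta x -> sml ltT (t x) by move=> [z [_ [Ux _ _]]]; apply: tU.
have uU3 eta : S2 eta -> unbounded_family t (U3 eta).
  move=> [_ _ u2] e; have [z [Uz ez]] := u2 e; have [[_ u1] _ _] := Uz.
  have [x [Ux _]] := u1 e; exists x; split; first by exists z.
  move=> a ta; have [_ H _] := Ux; have [L _ _] := H a ta.
  exact: (lt_tr woK (ez z erefl) L).
have [eh Heh] : exists eh : K -> K, forall eta, S2 eta ->
    forall s : K -> Prop, sml ltT s -> (forall b, s b -> ltK (eh eta) b) ->
    ev (fun i => exists x, [/\ U3 eta x, forall a, t x a -> ltK a (eh eta)
                              & forall a b, t x a -> s b -> h a b = i]).
  apply: (ac_in (P := S2) (R := fun eta e =>
    forall s : K -> Prop, sml ltT s -> (forall b, s b -> ltK e b) ->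
    ev (fun i => exists x, [/\ U3 eta x, forall a, t x a -> ltK a e
                              & forall a b, t x a -> s b -> h a b = i]))).
    exact: (s_inhK S).
  by move=> eta S2e; apply: Hh (uU3 _ S2e) => x; apply: sU3.
(* Closure under [eh] puts the left side of the rectangle chosen for [a1] below [b1]. *)
pose S3 eta := S2 eta /\ closure_pts ltK eh eta.
have uS3 : unbd ltK S3.
  move=> x; have [eta [[L C] ? ? ?]] :=
    H2 _ (club_inter2 (s_regK S) (club_tail (s_regK S) x) (closure_club (s_regK S) eh)).
  by exists eta; split=> //; split.
have [a1 [b1 [[S2a _] [[S2b [_ clb]] [a1b1 <-]]]]] := Hcc _ (unbd_card (s_regK S) uS3) g.
have ehb := clb _ a1b1.
have [e2a e1a _] := S2a; have [e2b e1b u2b] := S2b.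
have [b2 [Ub2 _]] := u2b k0K; have [[e1b2 u1b2] Hb2 gb2] := Ub2.
have [b12 Ab2 Ab2e] := Hb2 b2 erefl.
have [y [Uy _]] := u1b2 k0K; have [Uy' Hy gy] := Uy.
have e12 : ltK e1 e2 by rewrite -gb2; apply: (gapP (b := b2)).
have [|i0 Hi0] := Heh _ S2a (t y) (tU _ Uy').
  by move=> b tb; have [L _ _] := Hy b tb; exact: (lt_tr woK ehb (lt_tr woK b12 L)).
(* The pair of indices recurs cofinally among the values of [pi], so a realizable colour of [h] can
   code it. *)
have [i [pi_i i0i]] := Hpi (k1, k2) i0.
have [x [[a2 [Ua2 Ux]] xe hi]] := Hi0 i (lt_asym woT i0i).
have [[_ _] Ha2 ga2] := Ua2; have [a12 Aa2 Aa2e] := Ha2 a2 erefl.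
have [Ux' Hx gx] := Ux.
exists x, y; split=> // [a b ta tb|a b ta tb].
  have [L _ _] := Hy b tb.
  exact: (lt_tr woK (xe a ta) (lt_tr woK ehb (lt_tr woK b12 L))).
have [a2a Aa _] := Hx a ta; have [b2b Ab _] := Hy b tb.
have ab1 : ltK a b1 := lt_tr woK (xe a ta) ehb.
have e2a2 : ltK e2 a2 := lt_tr woK e2a a12.
rewrite (hi a b ta tb) pi_i; cbv zeta.
(* Points of [A b k1] below [b2] lie below the gap [e1], whereas [a] lies above [e1]; the next step
   works alike with [e2]. *)
have -> : next_above k1 a b = b2.
  apply: next_aboveE => //; first exact: (lt_asym woK (lt_tr woK ab1 b12)).
  move=> z Az zb; have := gapP tb Az zb; rewrite gy => L.
  exact: (lt_tr woK L (lt_tr woK e12 (lt_tr woK e2a2 a2a))).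
have -> : next_above k2 a b2 = b1.
  apply: next_aboveE => //; first exact: (lt_asym woK ab1).
  move=> z Az zb; have := gapP (s := sing b2) erefl Az zb; rewrite gb2 => L.
  exact: (lt_tr woK L (lt_tr woK e2a2 a2a)).
rewrite -/(sing b2) gb2.
(* On the left the search starts at [e2], which was recovered from the right side. *)
have -> : next_above k1 e2 a = a2.
  apply: next_aboveE => //; first exact: (lt_asym woK e2a2).
  by move=> z Az za; have := gapP ta Az za; rewrite gx => L; exact: (lt_tr woK L e12).
have -> // : next_above k2 e2 a2 = a1.
apply: next_aboveE => //; first exact: (lt_asym woK e2a).
by move=> z Az za; have := gapP (s := sing a2) erefl Az za; rewrite ga2.
Qed.

End Transformation.


(** * Counting codes for finite functions *)

Lemma card_le_sigT I (B : I -> Type) C : (forall i, card_le (B i) C) -> card_le {i & B i} (I * C).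
Proof.
move=> H; pose e i := proj1_sig (constructive_indefinite_description _ (H i)).
have ei i : injective (e i) by rewrite /e; case: constructive_indefinite_description.
exists (fun p => (projT1 p, e _ (projT2 p))) => -[i b] [j b'] /= [E].
by move: b'; rewrite -E => b' /ei ->.
Qed.

Lemma card_le_ffun (I : finType) B : card_le (I -> B) (list B).
Proof.
exists (fun f => map f (enum I)) => f g /eq_in_map E.
by apply: functional_extensionality => i; apply: E; rewrite mem_enum.
Qed.

Lemma card_le_map A B : card_le A B -> card_le (list A) (list B).
Proof. by move=> [f fi]; exists (map f); apply: inj_map. Qed.

Lemma card_le_ffun_to (I : finType) B C : card_le (list C) C -> card_le B C -> card_le (I -> B) C.
Proof.
move=> lC BC; apply: card_le_trans lC; apply: (card_le_trans (card_le_ffun I B)).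
exact: card_le_map.
Qed.

Lemma cantor A : ~ card_le (A -> bool) A.
Proof.
move=> /(card_le_surj (inhabits (fun _ : A => true))) [e He].
by have [a /(congr1 (fun f => f a))] := He (fun a => ~~ e a a); case: (e a a).
Qed.

(** * Partitions *)

Section Conclusion.
Variables (M : Type) (ltM : M -> M -> Prop) (K : Type) (ltK : K -> K -> Prop).
Variables (T : Type) (ltT : T -> T -> Prop) (c : T -> M).
Hypothesis S : setup ltM ltK ltT c.
Hypothesis K_succ : is_succ_card ltK M.
Variables (n : K -> nat) (p : forall d : K, K -> K -> 'I_(n d)).
Hypothesis sq : neg_sq_brackets ltK.
Let woK : is_wellorder ltK := s_woK S.

Lemma K_nat : card_le nat K.
Proof. exact: card_le_trans (s_M_nat S) (reg_le (s_regK S)). Qed.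

Lemma K_sq : card_le (K * K) K.
Proof. exact: square_le woK K_nat. Qed.

Lemma K_list : card_le (list K) K.
Proof. exact: list_le K_nat K_sq. Qed.

Lemma K_pair A B : card_le A K -> card_le B K -> card_le (A * B) K.
Proof. by move=> AK BK; apply: card_le_trans K_sq; apply: card_le_pair. Qed.

Lemma strong_coloring C : inhabited C -> card_le C K ->
  exists G : K -> K -> C, forall (t : K -> K -> Prop) (U : K -> Prop),
    (forall x, U x -> sml ltT (t x)) -> unbounded_family ltK t U -> forall g,
    exists x y, [/\ U x, U y, forall a b, t x a -> t y b -> ltK a b
                  & forall a b, t x a -> t y b -> G a b = g].
Proof.
move=> iC CK; have [dec Hdec] := card_le_surj iC CK.
have [k0] := s_inhK S; have [A [A1 A2 A3]] := guess_sets S k0.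
have [cc Hcc] := sq; have [G HG] := transform S k0 A1 A2 A3 Hcc.
exists (fun a b => dec (G a b)) => t U tU uU g; have [z <-] := Hdec g.
have [x [y [Ux Uy L E]]] := HG t U tU uU z.
by exists x, y; split=> // a b ta tb; rewrite (E a b ta tb).
Qed.

(** If every set had a point at or below [e], choosing one from each would inject [K] into a proper
    segment. *)
Lemma disjoint_unbounded (t : K -> K -> Prop) :
  (forall i j, i <> j -> forall x, t i x -> t j x -> False) ->
  unbounded_family ltK t (fun _ => True).
Proof.
move=> dj e; apply: NNPP => H.
have [phi Hphi] := ac (R := fun x a => t x a /\ ~ ltK e a) (fun x => NNPP _ (fun n' =>
   H (ex_intro _ x (conj I (fun a ta => NNPP _ (fun ea => n' (ex_intro _ a (conj ta ea)))))))).
have [e' ee'] := reg_above (s_regK S) e.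
have [_ [segK nKM]] := K_succ; apply: nKM; apply: card_le_trans (segK e').
have He x : ltK (phi x) e' by have [_ ex] := Hphi x; exact: (nlt_lt_tr woK ex ee').
exists (fun x => exist _ (phi x) (He x)) => x y [E]; apply: NNPP => xy.
have [tx _] := Hphi x; have [ty _] := Hphi y.
by apply: (dj x y xy _ tx); rewrite E.
Qed.

(** A colour is a pair of [d] and a function on ['I_(n d)], which is evaluated at [p d a b]. As
    [n d] is finite there are at most [K] many pairs, so one colouring serves all partitions. *)
Lemma Pr1_holds : (forall X, card_lt_cf ltM X ->
    forall t : K -> Prop, card_le {x | t x} X -> sml ltT t) -> Pr1_seq ltK ltM p.
Proof.
move=> Hsml; have [k0] := s_inhK S.
have [||G HG] := @strong_coloring {d : K & 'I_(n d) -> K}.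
- by constructor; exists k0.
- apply: card_le_trans K_sq; apply: card_le_sigT => d.
  exact: card_le_ffun_to K_list (card_le_refl K).
exists (fun a b => let: existT d z := G a b in z (p d a b)).
move=> d X cX F dj _ FX zeta.
have [x [y [_ _ L E]]] := HG F (fun _ => True) (fun x _ => Hsml X cX _ (FX x))
  (disjoint_unbounded dj) (existT _ d zeta).
by exists x, y; split=> // a b Fa Fb; rewrite (E a b Fa Fb).
Qed.

Lemma finite_sml xi (g : 'I_xi -> K) : sml ltT (fun a => exists i, g i = a).
Proof.
split; last first.
  apply: (cov_trans (s_inhK S) _ (cov_img g)); apply: card_le_trans (s_natT S).
  by exists (@nat_of_ord xi); apply: val_inj.
move=> u; suff [k Hk] : exists k, forall i, i \in enum 'I_xi -> ltT (u (g i)) k.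
  by exists k => _ [i <-]; apply: Hk; rewrite mem_enum.
elim: (enum 'I_xi) => [|i s [k Hk]]; first by have [k] := s_inhT S; exists k.
have [z [kz [iz _]]] := ex_ub2 (s_woT S) k (u (g i)); have [z' zz'] := s_T_above S z.
exists z' => j; rewrite inE => /orP [/eqP ->|/Hk L]; first exact: (nlt_lt_tr (s_woT S) iz zz').
exact: (lt_tr (s_woT S) (lt_nlt_tr (s_woT S) L kz) zz').
Qed.

Lemma pigeonhole_family B (t : K -> K -> Prop) (phi : K -> B) : card_le B M ->
  unbounded_family ltK t (fun _ => True) ->
  exists b, unbounded_family ltK t (fun x => phi x = b).
Proof.
move=> BM ut; apply: NNPP => nb.
have [bd Hbd] : exists bd : B -> K, forall b, ~ exists x, phi x = b /\ forall a, t x a -> ltK (bd b) a.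
  apply: (ac (R := fun b e => ~ exists x, phi x = b /\ forall a, t x a -> ltK e a)) => b.
  by apply: not_all_ex => H; apply: nb; exists b.
have [e He] := reg_bnd (s_regK S) bd BM; have [x [_ Hx]] := ut e.
apply: (Hbd (phi x)); exists x; split=> // a ta; exact: (lt_tr woK (He _) (Hx a ta)).
Qed.

(** The power set of [M] cannot be enumerated by a proper segment of [K], which has size at most
    [M]. *)
Lemma exists_reals : exists r : K -> M -> bool, injective r.
Proof.
have iB : inhabited (M -> bool) by exact: (inhabits (fun _ => true)).
case: (enum_dichotomy woK iB) => // -[w [e He]]; exfalso; apply: (@cantor M).
have [_ [segK _]] := K_succ; apply: card_le_trans (segK w).
apply: surj_card_le; exists (fun x => e (proj1_sig x)) => b.
by have [x [xw <-]] := He b; exists (exist _ x xw).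
Qed.

(** [D] collects, for each pair of distinct indices, one coordinate at which the two reals
    differ. *)
Lemma separating_list (r : K -> M -> bool) xi (g : 'I_xi -> K) : injective r -> injective g ->
  exists D : list M, injective (fun i => map (r (g i)) D).
Proof.
move=> ri gi.
have [m0] : inhabited M by have [f _] := s_M_nat S; exact: (inhabits (f 0)).
have [mm Hmm] : exists mm : 'I_xi * 'I_xi -> M, forall q, q.1 <> q.2 ->
    r (g q.1) (mm q) <> r (g q.2) (mm q).
  apply: (ac_in (P := fun q => q.1 <> q.2) (R := fun q m => r (g q.1) m <> r (g q.2) m)) => //.
  move=> [i j] /= ij; apply: not_all_ex => H; apply: ij; apply: gi; apply: ri.
  exact: functional_extensionality.
exists (map mm (enum (('I_xi * 'I_xi)%type : finType))) => i j /=.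
rewrite -(map_comp (r (g i)) mm) -(map_comp (r (g j)) mm) => /eq_in_map H; apply: NNPP => ij.
have Hm : (i, j) \in enum (('I_xi * 'I_xi)%type : finType) by rewrite mem_enum.
exact: (Hmm (i, j) ij (H _ Hm)).
Qed.

(* A colour codes finitely many coordinates of the reals [r a], the traces of
   the points of a tuple on them, and the matrix of colours to be realized. *)
Lemma Pr0_holds : Pr0_seq ltK p.
Proof.
have [k0] := s_inhK S; have [r ri] := exists_reals.
pose code d xi := (list M * ('I_xi -> list bool) * ('I_xi -> 'I_xi -> 'I_(n d) -> K))%type.
have boolK : card_le bool nat by exists (fun b : bool => b : nat) => -[] [].
have listM : card_le (list M) M := list_le (s_M_nat S) (s_M_sq S).
have lboolM : card_le (list bool) M.
  by apply: card_le_trans listM; apply: card_le_map; apply: card_le_trans (s_M_nat S).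
have MK := reg_le (s_regK S).
have [||G HG] := @strong_coloring {d : K & {xi : nat & code d xi}}.
- exact: (inhabits (existT _ k0 (existT _ 0 ([::], fun _ => [::], fun _ _ _ => k0)))).
- apply: card_le_trans K_sq; apply: card_le_sigT => d.
  apply: card_le_trans (K_pair K_nat (card_le_refl K)); apply: card_le_sigT => xi.
  apply: K_pair; last by do 3! apply: (card_le_ffun_to _ K_list); exact: card_le_refl.
  apply: K_pair; first exact: card_le_trans listM MK.
  exact: card_le_ffun_to K_list (card_le_trans lboolM MK).
(* The position of a point in its tuple is read off the trace of its real on [D]; the default [k0]
   is never reached on the tuples considered. *)
pose dec (a b : K) (z : {d : K & {xi : nat & code d xi}}) : K :=
  let: existT d (existT xi (D, P, Z)) := z in
  if [pick i | P i == map (r a) D] is Some i then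
    if [pick j | P j == map (r b) D] is Some j then Z i j (p d a b) else k0 else k0.
exists (fun a b => dec a b (G a b)) => d xi F Finc Fdj Z.
pose t k a := exists i, F k i = a.
have ut : unbounded_family ltK t (fun _ => True).
  by apply: disjoint_unbounded => k l kl a [i <-] [j E]; apply: (Fdj k l kl i j).
have Finj k : injective (F k).
  move=> i j E; apply: val_inj; apply: NNPP => /eqP; rewrite neq_ltn => /orP [] /(Finc k);
  by rewrite E; apply: (@lt_irr _ _ woK).
have [D HD] := ac (fun k => separating_list ri (@Finj k)).
(* There are at most [M] many lists with traces, so one choice is common to an unbounded subfamily
   and a single colour can name it. *)
have [[D0 P] uD] : exists q, unbounded_family ltK t
    (fun k => (D k, fun i => map (r (F k i)) (D k)) = q).
  apply: pigeonhole_family => //; apply: card_le_trans (s_M_sq S); apply: card_le_pair => //.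
  by apply: card_le_ffun_to.
have [k [l [Uk Ul L E]]] := HG t _ (fun k _ => finite_sml (F k)) uD (existT _ d (existT _ xi (D0, P, Z))).
have pickE k' (i : 'I_xi) : (D k', fun i => map (r (F k' i)) (D k')) = (D0, P) ->
    [pick i' | P i' == map (r (F k' i)) D0] = Some i.
  move=> [E1 E2]; have Pinj : injective P by rewrite -E2; apply: HD.
  rewrite -E1; case: pickP => [i' /eqP Ei|/(_ i)]; last by rewrite -E2 eqxx.
  by congr Some; apply: Pinj; rewrite Ei -E2.
exists k, l; split=> i j; first by apply: L; [exists i|exists j].
rewrite (E (F k i) (F l j)); [|by exists i|by exists j].
by rewrite /dec !pickE.
Qed.

End Conclusion.

Theorem theorem4p8 (M : Type) (ltM : M -> M -> Prop)
  (K : Type) (ltK : K -> K -> Prop) :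
  singular_cardinal ltM ->
  is_succ_card ltK M ->
  forall (n : K -> nat) (p : forall d : K, K -> K -> 'I_(n d)),
  neg_sq_brackets ltK ->
  Pr1_seq ltK ltM p /\ Pr0_seq ltK p.
Proof.
move=> sM sK n p sq; have [T [ltT [c [S Hsml]]]] := setup_exists sM sK.
split; first exact: (Pr1_holds S sK p sq Hsml).
exact: (Pr0_holds S sK p sq).
Qed.
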